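(* Let $V_1,\dots,V_m$ be finitely generated injective $\mathcal{C}$-modules over $k$. Then the external tensor product $V_1\boxtimes V_2\boxtimes\cdots\boxtimes V_m$ is a finitely generated injective $\mathcal{C}^m$-module. In particular, every finitely generated projective $\mathcal{C}^m$-module is also injective.
   Context: Throughout, $m$ is a positive integer and $k$ is a field of characteristic $0$. $\mathcal{C}=\mathrm{FI}$ is the category of finite sets and injections, and $\mathcal{C}^m=\mathrm{FI}^m$ is its $m$-fold product: objects are $m$-tuples $\mathbf{S}=(S_1,\dots,S_m)$ of finite sets, and morphisms $\mathbf{S}\to\mathbf{S}'$ are $m$-tuples $(f_1,\dots,f_m)$ of injections $f_i:S_i\to S_i'$. A $\mathcal{C}^m$-module is a covariant functor from $\mathcal{C}^m$ to the category of $k$-vector spaces; $\mathcal{C}^m$-modules with natural transformations form an abelian category $\mathcal{C}^m\text{-Mod}$ (for $m=1$: $\mathcal{C}\text{-Mod}$). Injective and projective modules are the injective and projective objects of this category. For an object $\mathbf{S}$, $M(\mathbf{S})$ denotes the $\mathcal{C}^m$-module sending $\mathbf{T}$ to the $k$-vector space with basis $\mathcal{C}^m(\mathbf{S},\mathbf{T})$. A $\mathcal{C}^m$-module is finitely generated if it is a quotient of a finite direct sum of modules of the form $M(\mathbf{S})$. Given $\mathcal{C}$-modules $V_1,\dots,V_m$, their external tensor product is the $\mathcal{C}^m$-module with $(V_1\boxtimes\cdots\boxtimes V_m)(S_1,\dots,S_m)=V_1(S_1)\otimes_k\cdots\otimes_k V_m(S_m)$ and $(V_1\boxtimes\cdots\boxtimes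 V_m)(\alpha_1,\dots,\alpha_m)=V_1(\alpha_1)\otimes_k\cdots\otimes_k V_m(\alpha_m)$. *)

(* Defs.v *)
From HB Require Import structures.
From mathcomp Require Import all_boot all_algebra.
From mathcomp Require Import boolp.
From mathcomp Require Import finmap.
From mathcomp Require Import monalg.

Set Implicit Arguments.
Unset Strict Implicit.
Unset Printing Implicit Defensive.

Import GRing.Theory.
Local Open Scope ring_scope.

Section Tensor.
Variables (k : fieldType) (m : nat) (V : 'I_m -> lmodType k).

(* [dfwith x u] is the family x with its i-th entry replaced by u : V i. *)
Definition multilinear (W : lmodType k) (phi : (forall i, V i) -> W) :=
  forall (x : forall i, V i) (i : 'I_m) (a : k) (u v : V i),
    phi (dfwith x (a *: u + v)) = a *: phi (dfwith x u) + phi (dfwith x v).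

(* The vector space with basis the set of all families (x_i)_i, x_i in V_i. *)
Definition tensor_pre := {malg k[{classic forall i, V i}]}.

Definition tensor_gen (x : forall i, V i) : tensor_pre :=
  mkmalgU (x : {classic forall i, V i}) 1.

(* The subspace of tensor_pre spanned by the multilinearity relations, as the
   intersection of all subspaces that contain them. *)
Definition tensor_rel (t : tensor_pre) : Prop :=
  forall P : tensor_pre -> Prop,
    P 0 ->
    (forall a s t, P s -> P t -> P (a *: s + t)) ->
    (forall (x : forall i, V i) i a (u v : V i),
       P (tensor_gen (dfwith x (a *: u + v))
          - (a *: tensor_gen (dfwith x u) + tensor_gen (dfwith x v)))) ->
    P t.

Definition tensor_relb (t : tensor_pre) : bool := `[< tensor_rel t >].

Lemma tensor_relb_closed : submod_closed tensor_relb.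
Proof.
split; first by apply/asboolP => P.
move=> a s t /asboolP Hs /asboolP Ht; apply/asboolP => P P0 PD PM.
by apply: (PD); [apply: Hs | apply: Ht].
Qed.

HB.instance Definition _ := GRing.isZmodClosed.Build tensor_pre tensor_relb
  (GRing.submod_closedB tensor_relb_closed).
HB.instance Definition _ := GRing.isScaleClosed.Build k tensor_pre tensor_relb
  (GRing.subsemimod_closedZ tensor_relb_closed).

Definition tensor_relc : zmodClosed tensor_pre :=
  GRing.ZmodClosed.clone tensor_pre tensor_relb _.

Definition tensor : Type := Quotient.quot tensor_relc.

HB.instance Definition _ := GRing.Zmodule.on tensor.

Definition tensor_pi (t : tensor_pre) : tensor :=
  \pi_(Quotient.quot tensor_relc)%qT t.

Definition tensor_repr (t : tensor) : tensor_pre :=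
  generic_quotient.repr (t : Quotient.quot tensor_relc).

Lemma tensor_reprK t : tensor_pi (tensor_repr t) = t.
Proof. exact: generic_quotient.reprK. Qed.

Lemma tensor_piP s t : reflect (tensor_pi s = tensor_pi t) (tensor_relb (s - t)).
Proof.
have -> : tensor_relb (s - t) = (tensor_pi s == tensor_pi t).
  exact: (Quotient.idealrBE tensor_relc).
exact: eqP.
Qed.

Lemma tensor_piD s t : tensor_pi (s + t) = tensor_pi s + tensor_pi t.
Proof. exact: (Quotient.pi_add tensor_relc). Qed.

Definition tensor_scale (a : k) (t : tensor) := tensor_pi (a *: tensor_repr t).

Lemma tensor_pi_scale a s : tensor_pi (a *: s) = tensor_scale a (tensor_pi s).
Proof.
apply/tensor_piP; rewrite -scalerBr.
have : tensor_relb (s - tensor_repr (tensor_pi s)).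
  by apply/tensor_piP; rewrite tensor_reprK.
exact: (rpredZ a).
Qed.

Fact tensor_scaleA a b t :
  tensor_scale a (tensor_scale b t) = tensor_scale (a * b) t.
Proof. by rewrite -[t]tensor_reprK -!tensor_pi_scale scalerA. Qed.

Fact tensor_scale1 : left_id 1 tensor_scale.
Proof. by move=> t; rewrite -[t]tensor_reprK -tensor_pi_scale scale1r. Qed.

Fact tensor_scaleDr : right_distributive tensor_scale +%R.
Proof.
move=> a s t; rewrite -[s]tensor_reprK -[t]tensor_reprK.
by rewrite -tensor_piD -!tensor_pi_scale -tensor_piD scalerDr.
Qed.

Fact tensor_scaleDl t : {morph tensor_scale^~ t : a b / a + b}.
Proof.
by move=> a b; rewrite -[t]tensor_reprK -!tensor_pi_scale -tensor_piD scalerDl.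
Qed.

HB.instance Definition _ := GRing.Zmodule_isLmodule.Build k tensor
  tensor_scaleA tensor_scale1 tensor_scaleDr tensor_scaleDl.

Lemma tensor_piZ a s : tensor_pi (a *: s) = a *: tensor_pi s.
Proof. exact: tensor_pi_scale. Qed.

Definition pure_tensor (x : forall i, V i) : tensor := tensor_pi (tensor_gen x).

Lemma pure_tensor_multilinear : multilinear pure_tensor.
Proof.
move=> x i a u v; rewrite -tensor_piZ -tensor_piD.
by apply/tensor_piP/asboolP => P P0 PD; apply.
Qed.

Section Lift.
Variables (W : lmodType k) (phi : (forall i, V i) -> W).

Definition tensor_pre_lift (t : tensor_pre) : W :=
  \sum_(x <- msupp t) mcoeff x t *: phi x.

Lemma tensor_pre_liftE (t : tensor_pre) (d : {fset {classic forall i, V i}}) :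
  (msupp t `<=` d)%fset -> tensor_pre_lift t = \sum_(x <- d) mcoeff x t *: phi x.
Proof.
move=> sub; apply: big_fset_incl => // x _ xt.
by rewrite mcoeff_outdom // scale0r.
Qed.

Lemma tensor_pre_lift_linear : linear tensor_pre_lift.
Proof.
move=> a s t.
pose d := (msupp (a *: s + t) `|` (msupp s `|` msupp t))%fset.
rewrite !(@tensor_pre_liftE _ d);
  first last.
- exact: fsubsetUl.
- by rewrite /d fsetUA fsetUAC fsubsetUr.
- by rewrite /d fsetUA fsubsetUr.
rewrite scaler_sumr -big_split; apply: eq_bigr => x _ /=.
by rewrite mcoeffD mcoeffZ scalerDl scalerA.
Qed.

HB.instance Definition _ :=
  GRing.isLinear.Build k tensor_pre W _ tensor_pre_lift tensor_pre_lift_linear.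

Lemma tensor_pre_lift_gen x : tensor_pre_lift (tensor_gen x) = phi x.
Proof.
rewrite /tensor_pre_lift /tensor_gen msuppU oner_eq0 big_seq_fset1.
by rewrite mcoeffUU scale1r.
Qed.

Definition tensor_lift (t : tensor) : W := tensor_pre_lift (tensor_repr t).

Hypothesis phiM : multilinear phi.

Lemma tensor_lift_pi t : tensor_lift (tensor_pi t) = tensor_pre_lift t.
Proof.
apply/eqP; rewrite -subr_eq0 -linearB; apply/eqP.
have /tensor_piP/asboolP := tensor_reprK (tensor_pi t).
move/(_ (fun s => tensor_pre_lift s = 0)); apply=> [|a u v|x i a u v].
- exact: linear0.
- by move=> u0 v0; rewrite linearP /= u0 v0 scaler0 addr0.
- by rewrite linearB linearP /= !tensor_pre_lift_gen phiM subrr.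
Qed.

Lemma tensor_lift_linear : linear tensor_lift.
Proof.
move=> a s t; rewrite -[s]tensor_reprK -[t]tensor_reprK.
by rewrite -tensor_piZ -tensor_piD !tensor_lift_pi linearP.
Qed.

Lemma tensor_lift_pure x : tensor_lift (pure_tensor x) = phi x.
Proof. by rewrite tensor_lift_pi tensor_pre_lift_gen. Qed.

End Lift.

Lemma tensor_ext (W : lmodType k) (f g : {linear tensor -> W}) :
  (forall x, f (pure_tensor x) = g (pure_tensor x)) -> f =1 g.
Proof.
move=> fg t; rewrite -[t]tensor_reprK; move: (tensor_repr t) => s.
rewrite [s]monalgE.
have piS (r : seq {classic forall i, V i}) :
    tensor_pi (\sum_(x <- r) mkmalgU x (mcoeff x s))
    = \sum_(x <- r) mcoeff x s *: pure_tensor x.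
  elim: r => [|x r IH].
    by rewrite !big_nil; apply: (addIr (tensor_pi 0)); rewrite -tensor_piD !add0r.
  rewrite !big_cons tensor_piD IH; congr (_ + _).
  rewrite -tensor_piZ; congr tensor_pi.
  by apply/malgP => y; rewrite mcoeffZ !mcoeffU mulrnAr mulr1.
rewrite piS !linear_sum; apply: eq_bigr => x _.
by rewrite !linearZ fg.
Qed.

Theorem tensor_universal (W : lmodType k) (phi : (forall i, V i) -> W) :
  multilinear phi ->
  exists f : {linear tensor -> W},
    (forall x, f (pure_tensor x) = phi x) /\
    (forall g : {linear tensor -> W},
       (forall x, g (pure_tensor x) = phi x) -> g =1 f).
Proof.
move=> phiM.
pose fM := GRing.isLinear.Build k tensor W _ _ (tensor_lift_linear phiM).
pose f : {linear tensor -> W} := HB.pack (tensor_lift phi) fM.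
have fE x : f (pure_tensor x) = phi x by apply: tensor_lift_pure.
by exists f; split=> // g gE; apply: tensor_ext => x; rewrite fE gE.
Qed.

End Tensor.

Section TensorMap.
Variables (k : fieldType) (m : nat) (V W : 'I_m -> lmodType k).
Variable f : forall i, {linear V i -> W i}.

Definition tensor_map_pure (x : forall i, V i) : tensor W :=
  pure_tensor (fun i => f i (x i)).

Lemma tensor_map_pureP : multilinear tensor_map_pure.
Proof.
have fdf x i (w : V i) :
    (fun j => f j (dfwith x w j)) = dfwith (fun j => f j (x j)) (f i w).
  apply: functional_extensionality_dep => j.
  by case: dfwithP => [|l il]; rewrite ?dfwith_in ?dfwith_out.
move=> x i a u v; rewrite /tensor_map_pure !fdf linearP.
exact: pure_tensor_multilinear.
Qed.

Definition tensor_map_fun : tensor V -> tensor W := tensor_lift tensor_map_pure.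

HB.instance Definition _ := GRing.isLinear.Build k (tensor V) (tensor W) _
  tensor_map_fun (tensor_lift_linear tensor_map_pureP).

Definition tensor_map : {linear tensor V -> tensor W} := tensor_map_fun.

Lemma tensor_map_pure_tensor x :
  tensor_map (pure_tensor x) = pure_tensor (fun i => f i (x i)).
Proof. exact: (tensor_lift_pure tensor_map_pureP). Qed.

End TensorMap.

(* compm g f is the composite g o f. *)
Record fincat := FinCat {
  Ob : Type;
  Hom : Ob -> Ob -> finType;
  idm : forall S, Hom S S;
  compm : forall S T U, Hom T U -> Hom S T -> Hom S U;
  comp1m : forall S T (f : Hom S T), compm (idm T) f = f;
  compm1 : forall S T (f : Hom S T), compm f (idm S) = f;
  compmA : forall S T U R (h : Hom U R) (g : Hom T U) (f : Hom S T),
    compm h (compm g f) = compm (compm h g) f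
}.

Section FI.

Definition FI_hom (S T : finType) : finType :=
  {f : {ffun S -> T} | injectiveb f}.

Definition FI_fun (S T : finType) (f : FI_hom S T) : S -> T := val f.

Lemma FI_inj (S T : finType) (f : FI_hom S T) : injective (FI_fun f).
Proof. exact/injectiveP/(valP f). Qed.

Lemma FI_homP (S T : finType) (f g : FI_hom S T) :
  FI_fun f =1 FI_fun g -> f = g.
Proof. by move=> fg; apply/val_inj/ffunP. Qed.

Fact FI_mk_subproof (S T : finType) (f : S -> T) :
  injective f -> injectiveb [ffun x => f x].
Proof. by move=> fI; apply/injectiveP => x y; rewrite !ffunE => /fI. Qed.

Definition FI_mk (S T : finType) (f : S -> T) (fI : injective f) : FI_hom S T :=
  exist _ [ffun x => f x] (FI_mk_subproof fI).

Lemma FI_mkE (S T : finType) (f : S -> T) (fI : injective f) :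
  FI_fun (FI_mk fI) =1 f.
Proof. by move=> x; rewrite /FI_fun ffunE. Qed.

Definition FI_id (S : finType) : FI_hom S S := FI_mk (@inj_id S).

Definition FI_comp (S T U : finType) (g : FI_hom T U) (f : FI_hom S T) :
  FI_hom S U := FI_mk (inj_comp (@FI_inj _ _ g) (@FI_inj _ _ f)).

Fact FI_comp1m (S T : finType) (f : FI_hom S T) : FI_comp (FI_id T) f = f.
Proof. by apply: FI_homP => x; rewrite !FI_mkE /= FI_mkE. Qed.

Fact FI_compm1 (S T : finType) (f : FI_hom S T) : FI_comp f (FI_id S) = f.
Proof. by apply: FI_homP => x; rewrite !FI_mkE /= FI_mkE. Qed.

Fact FI_compmA (S T U R : finType)
    (h : FI_hom U R) (g : FI_hom T U) (f : FI_hom S T) :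
  FI_comp h (FI_comp g f) = FI_comp (FI_comp h g) f.
Proof. by apply: FI_homP => x; rewrite !FI_mkE /= !FI_mkE. Qed.

Definition FI : fincat := FinCat FI_comp1m FI_compm1 FI_compmA.

End FI.

Section PowerCategory.
Variables (C : fincat) (m : nat).

Definition pow_obj := 'I_m -> Ob C.

Definition pow_hom (S T : pow_obj) : finType :=
  {dffun forall i : 'I_m, Hom (S i) (T i)}.

Definition pow_id (S : pow_obj) : pow_hom S S := [ffun i => idm (S i)].

Definition pow_comp (S T U : pow_obj) (g : pow_hom T U) (f : pow_hom S T) :
  pow_hom S U := [ffun i => compm (g i) (f i)].

Fact pow_comp1m S T (f : pow_hom S T) : pow_comp (pow_id T) f = f.
Proof. by apply/ffunP => i; rewrite !ffunE comp1m. Qed.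

Fact pow_compm1 S T (f : pow_hom S T) : pow_comp f (pow_id S) = f.
Proof. by apply/ffunP => i; rewrite !ffunE compm1. Qed.

Fact pow_compmA S T U R (h : pow_hom U R) (g : pow_hom T U) (f : pow_hom S T) :
  pow_comp h (pow_comp g f) = pow_comp (pow_comp h g) f.
Proof. by apply/ffunP => i; rewrite !ffunE compmA. Qed.

Definition pow_cat : fincat := FinCat pow_comp1m pow_compm1 pow_compmA.

End PowerCategory.

Section Modules.
Variables (C : fincat) (k : fieldType).

Record module := Module {
  mod_obj :> Ob C -> lmodType k;
  mod_map : forall S T, Hom S T -> {linear mod_obj S -> mod_obj T};
  mod_map_id : forall S x, mod_map (idm S) x = x;
  mod_map_comp : forall S T U (g : Hom T U) (f : Hom S T) x,
    mod_map (compm g f) x = mod_map g (mod_map f x)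
}.

Record nattrans (X Y : module) := NatTrans {
  nt_app :> forall S, {linear X S -> Y S};
  nt_natural : forall S T (f : Hom S T) x,
    nt_app T (mod_map X f x) = mod_map Y f (nt_app S x)
}.

Definition nt_eq (X Y : module) (f g : nattrans X Y) := forall S, f S =1 g S.

Definition nt_comp (X Y Z : module) (g : nattrans Y Z) (f : nattrans X Y) :
  nattrans X Z.
Proof.
exists (fun S => (g S \o f S) : {linear X S -> Z S}) => S T h x /=.
by rewrite !nt_natural.
Defined.

Definition is_mono (X Y : module) (i : nattrans X Y) :=
  forall (Z : module) (f g : nattrans Z X),
    nt_eq (nt_comp i f) (nt_comp i g) -> nt_eq f g.

Definition is_epi (X Y : module) (p : nattrans X Y) :=
  forall (Z : module) (f g : nattrans Y Z),
    nt_eq (nt_comp f p) (nt_comp g p) -> nt_eq f g.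

Definition injective_module (E : module) :=
  forall (X Y : module) (i : nattrans X Y) (f : nattrans X E),
    is_mono i -> exists g : nattrans Y E, nt_eq (nt_comp g i) f.

Definition projective_module (P : module) :=
  forall (X Y : module) (p : nattrans X Y) (f : nattrans P Y),
    is_epi p -> exists g : nattrans P X, nt_eq (nt_comp p g) f.

(* [free_module S] is M(S). The basis vector of M(S)(T) attached to
   f : Hom S T is its indicator function [free_basis f]. *)
Section FreeModule.
Variable S : Ob C.

Definition free_obj (T : Ob C) : lmodType k := {ffun Hom S T -> k^o}.

Definition free_basis (T : Ob C) (f : Hom S T) : free_obj T :=
  [ffun g => (g == f)%:R].

Section Map.
Variables (T U : Ob C) (g : Hom T U).

Definition free_map_fun (v : free_obj T) : free_obj U :=
  [ffun h => \sum_(f | compm g f == h) v f].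

Fact free_map_linear : linear free_map_fun.
Proof.
move=> a v w; apply/ffunP => h; rewrite !ffunE scaler_sumr -big_split.
by apply: eq_bigr => f _; rewrite !ffunE.
Qed.

HB.instance Definition _ := GRing.isLinear.Build k (free_obj T) (free_obj U) _
  free_map_fun free_map_linear.

Definition free_map : {linear free_obj T -> free_obj U} := free_map_fun.

End Map.

Lemma free_map_basis T U (g : Hom T U) (f : Hom S T) :
  free_map g (free_basis f) = free_basis (compm g f).
Proof.
apply/ffunP => h; rewrite !ffunE.
under eq_bigr do rewrite ffunE.
case: eqVneq => [->|neq].
  by rewrite (bigD1 f) //= eqxx big1 ?addr0 // => f' /andP[_ /negPf ->].
rewrite big1 // => f' /eqP eh; case: eqVneq => // e.
by rewrite -e eh eqxx in neq.
Qed.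

Fact free_map_id T x : free_map (idm T) x = x.
Proof.
apply/ffunP => h; rewrite ffunE (eq_bigl (pred1 h)) ?big_pred1_eq //.
by move=> f; rewrite /= comp1m.
Qed.

Fact free_map_comp T U R (g : Hom U R) (f : Hom T U) x :
  free_map (compm g f) x = free_map g (free_map f x).
Proof.
apply/ffunP => h; rewrite !ffunE.
under [RHS]eq_bigr do rewrite ffunE.
rewrite (exchange_big_dep (fun e => compm (compm g f) e == h)) /=; last first.
  by move=> e e' /eqP <- /eqP <-; rewrite compmA.
apply: eq_bigr => e /eqP eh; rewrite (big_pred1 (compm f e)) // => e' /=.
rewrite [compm f e == e']eq_sym.
by case: (eqVneq e') => [->|]; rewrite ?andbF // compmA eh eqxx.
Qed.

Definition free_module : module := Module free_map_id free_map_comp.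

End FreeModule.

Section DirectSum.

Definition zero_module : module.
Proof.
by exists (fun=> 'rV[k]_0 : lmodType k) (fun _ _ _ => idfun).
Defined.

Variables X Y : module.

Section Map.
Variables (S T : Ob C) (f : Hom S T).

Definition dsum_map_fun (v : X S * Y S) : X T * Y T :=
  (mod_map X f v.1, mod_map Y f v.2).

Fact dsum_map_linear : linear dsum_map_fun.
Proof. by move=> a v w; rewrite /dsum_map_fun /= !linearP. Qed.

HB.instance Definition _ := GRing.isLinear.Build k (X S * Y S)%type
  (X T * Y T)%type _ dsum_map_fun dsum_map_linear.

End Map.

Definition dsum : module.
Proof.
exists (fun S => (X S * Y S)%type : lmodType k)
       (fun S T f => @dsum_map_fun S T f) => [S [x y]|S T U g f [x y]] /=.
  by rewrite /dsum_map_fun /= !mod_map_id.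
by rewrite /dsum_map_fun /= !mod_map_comp.
Defined.

End DirectSum.

Definition free_modules (s : seq (Ob C)) : module :=
  foldr (fun S X => dsum (free_module S) X) zero_module s.

(* A quotient is the target of a pointwise surjective natural transformation. *)
Definition finitely_generated (X : module) :=
  exists (s : seq (Ob C)) (p : nattrans (free_modules s) X),
    forall (S : Ob C) (x : X S), exists y, p S y = x.

End Modules.

Section ExternalTensor.
Variables (C : fincat) (k : fieldType) (m : nat) (V : 'I_m -> module C k).

Definition ext_tensor_obj (S : Ob (pow_cat C m)) : lmodType k :=
  tensor (fun i => V i (S i)).

Definition ext_tensor_map (S T : Ob (pow_cat C m)) (f : Hom S T) :
  {linear ext_tensor_obj S -> ext_tensor_obj T} :=
  tensor_map (fun i => mod_map (V i) (f i)).

Definition ext_tensor : module (pow_cat C m) k.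
Proof.
exists ext_tensor_obj ext_tensor_map => [S|S T U g f].
  apply: (@tensor_ext _ _ _ _ _ idfun) => x; rewrite tensor_map_pure_tensor.
  congr pure_tensor; apply: functional_extensionality_dep => i.
  by rewrite ffunE mod_map_id.
apply: (@tensor_ext _ _ _ _ _ (_ \o _)) => x /=.
rewrite !tensor_map_pure_tensor.
congr pure_tensor; apply: functional_extensionality_dep => i.
by rewrite ffunE mod_map_comp.
Defined.

End ExternalTensor.

(* Main.v *)
From HB Require Import structures.
From mathcomp Require Import all_boot all_algebra all_fingroup.
From mathcomp Require Import boolp.
From mathcomp Require classical_sets.
Require Import Defs.

Set Implicit Arguments.
Unset Strict Implicit.
Unset Printing Implicit Defensive.

Import GRing.Theory.
Local Open Scope ring_scope.

(** For a presheaf Z of finite sets on a category C, let [cofun k Z] be the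
    C-module of functions on Z. A morphism from X to it is a linear functional on
    the colimit of X over the category of elements of Z, so [cofun k Z] is
    injective as soon as this colimit is exact in X. Exactness holds when each
    element (T, z) admits averages of morphisms to the terms of a fixed sequence
    of elements, compatible with all morphisms ([averaging], [cofun_injective]):
    the colimit then becomes one along a sequence. Representable presheaves have
    such averages for trivial reasons. Over FI the presheaf [pinj D] of partial
    injections T -> D has them in characteristic 0: complete a partial injection
    to an injection of T into D plus n points in all possible ways and take the
    mean. Averages are inherited by finite coproducts and by external products.

    The main step ([fg_injective_retract]) is that every finitely generated
    injective FI-module V is a retract of some [cofun k Z] with averages; for this
    V is embedded in such a module. Finitely many morphisms to [cofun k Z] separate
    the elements of V that any morphisms separate ([cofun_embedding]), and an
    element is separated from 0 unless its averages eventually vanish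
    ([cofun_separates]). Let d bound the degrees of the generators. By an argument
    of Maschke type, v in V(T) with #|T| = d + n is 0 if its n-th averages over all
    partial injections to a set of d elements vanish ([avg_type_neq0]); and for
    n large the n-th averages vanish if the later ones do, because the linear
    relations between the averages of the generators stabilise
    ([avg_eq0_stable]). The finitely many remaining degrees are treated with
    representable presheaves.

    The external tensor product of the function modules of Z_1, ..., Z_m is the
    function module of the external product of the Z_i, and external tensor products
    preserve retracts, so the product of the V_i is injective. Products of
    generators generate it.

    As for projectives, M(D) over FI is a retract of [cofun k (pinj D)] by Moebius
    inversion ([free_module_FI_retract]), hence injective. Over the m-th power of FI,
    M(S) is the external tensor product of the M(S_i), hence injective by the first
    part, and a finitely generated projective is a retract of a finite sum of such
    modules. *)

(** * Linear algebra without dimension hypotheses *)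

Definition subspace (k : fieldType) (U : lmodType k) (S : U -> Prop) :=
  S 0 /\ forall a u v, S u -> S v -> S (a *: u + v).

Section Subspace.
Variables (k : fieldType) (U : lmodType k) (S : U -> Prop).
Hypothesis subS : subspace S.

Lemma subspace0 : S 0. Proof. exact: subS.1. Qed.

Lemma subspaceP a u v : S u -> S v -> S (a *: u + v).
Proof. exact: subS.2. Qed.

Lemma subspaceD u v : S u -> S v -> S (u + v).
Proof. by move=> Su Sv; rewrite -[u]scale1r; apply: subspaceP. Qed.

Lemma subspaceZ a u : S u -> S (a *: u).
Proof. by move=> Su; rewrite -[_ *: u]addr0; apply/subspaceP/subspace0. Qed.

Lemma subspaceN u : S u -> S (- u).
Proof. by rewrite -scaleN1r; apply: subspaceZ. Qed.

Lemma subspaceB u v : S u -> S v -> S (u - v).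
Proof. by move=> Su Sv; apply/subspaceD/subspaceN. Qed.

Lemma subspace_sum I (r : seq I) (P : pred I) (F : I -> U) :
  (forall i, P i -> S (F i)) -> S (\sum_(i <- r | P i) F i).
Proof. by move=> SF; apply: big_ind => //; [apply: subspace0 | apply: subspaceD]. Qed.

End Subspace.

Lemma subspace_complement (k : fieldType) (U : lmodType k) (S : U -> Prop) :
  subspace S ->
  exists C : U -> Prop, [/\ subspace C, (forall u, C u -> S u -> u = 0)
    & forall u, exists s, S s /\ C (u - s)].
Proof.
move=> subS.
(* A chain may be empty, so membership of 0 is left out of the property
   submitted to Zorn's lemma and recovered from maximality. *)
pose indep (C : U -> Prop) := (forall a u v, C u -> C v -> C (a *: u + v)) /\
  (forall u, C u -> S u -> u = 0).
have [|C [[linC CS0] maxC]] := @classical_sets.Zorn_bigcup U indep.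
  move=> F Findep Ftot; split=> [a u v [A FA Au] [B FB Bv]|u [A FA Au] Su].
    have [AB|BA] := Ftot A B FA FB.
      by exists B => //; apply: (Findep B FB).1 => //; apply: AB.
    by exists A => //; apply: (Findep A FA).1 => //; apply: BA.
  exact: (Findep A FA).2.
have C0 : C 0.
  have [//|nC0] := pselect (C 0).
  have Cempty u : ~ C u.
    by move=> Cu; apply: nC0; rewrite -[0](addNr u) -scaleN1r; apply: linC.
  case: (maxC (fun u => u = 0)); last first.
    split=> [a u v -> ->|u -> //]; rewrite scaler0 addr0 //.
  by split=> [u /Cempty //|sub]; apply: (Cempty 0); apply: sub.
have subC : subspace C by [].
exists C; split=> // u; have [//|nu] := pselect (exists s, S s /\ C (u - s)).
have span_indep : indep (fun w => exists a, C (w - a *: u)).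
  split=> [a v w [b Cb] [c Cc]|w [a Ca] Sw].
    exists (a * b + c); rewrite scalerDl opprD addrACA -scalerA -scalerBr.
    exact: linC.
  have a0 : a = 0.
    apply: contrapT => /eqP a0; apply: nu; exists (a^-1 *: w).
    split; first exact: subspaceZ.
    rewrite -[u](scalerK a0) -scalerBr -opprB scalerN -scaleNr.
    exact: subspaceZ.
  by apply: CS0 => //; rewrite a0 scale0r subr0 in Ca.
case: (maxC _ _ span_indep); split=> [|sub].
  by move=> w Cw; exists 0; rewrite scale0r subr0.
have Cu : C u by apply: sub; exists 1; rewrite scale1r subrr.
by apply: nu; exists 0; split; [apply: subspace0 subS | rewrite subr0].
Qed.

Lemma linear_of_fun (k : fieldType) (U W : lmodType k) (f : U -> W) :
  linear f -> {g : {linear U -> W} | g =1 f}.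
Proof.
move=> lin_f; pose fM := GRing.isLinear.Build k U W _ f lin_f.
by exists (HB.pack f fM : {linear U -> W}).
Qed.

Lemma subspace_projector (k : fieldType) (U : lmodType k) (S : U -> Prop) :
  subspace S ->
  exists pi : {linear U -> U}, (forall u, S (pi u)) /\ forall u, S u -> pi u = u.
Proof.
move=> subS; have [C [subC CS0 decC]] := subspace_complement subS.
have [f fP] := choice decC.
have f_uniq u s : S s -> C (u - s) -> f u = s.
  move=> Ss Cs; apply/eqP; rewrite -subr_eq0; apply/eqP/CS0; last first.
    by apply: subspaceB => //; case: (fP u).
  by rewrite -[f u](subKr u) -addrAC; apply: subspaceB; last case: (fP u).
have lin_f : linear f.
  move=> a u v; have [Su Cu] := fP u; have [Sv Cv] := fP v.
  apply: f_uniq; first exact: subspaceP.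
  by rewrite opprD addrACA -scalerBr; apply: subspaceP.
have [pi piE] := linear_of_fun lin_f; exists pi; split=> u => [|Su].
  by rewrite piE; case: (fP u).
by rewrite piE; apply: f_uniq => //; rewrite subrr; apply: subspace0 subC.
Qed.

(** P is the graph of a partial functional: compose it with a projector onto its
    domain. *)
Lemma functional_extension (k : fieldType) (U : lmodType k) (P : U -> k -> Prop) :
  P 0 0 ->
  (forall a u v c e, P u c -> P v e -> P (a *: u + v) (a * c + e)) ->
  (forall c, P 0 c -> c = 0) ->
  exists L : {linear U -> k^o}, forall u c, P u c -> L u = c.
Proof.
move=> P0 PD Puniq.
have P_fun u c e : P u c -> P u e -> c = e.
  move=> Pc Pe; apply/eqP; rewrite -subr_eq0 addrC -mulN1r; apply/eqP/Puniq.
  by rewrite -(addNr u) -scaleN1r; apply: PD.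
have [|pi [piP pi_id]] := @subspace_projector k U (fun u => exists c, P u c).
  split; first by exists 0.
  by move=> a u v [c Pc] [e Pe]; exists (a * c + e); apply: PD.
have [f fP] := choice piP.
have lin_f : linear (f : U -> k^o).
  by move=> a u v; apply: (P_fun (pi (a *: u + v))) => //; rewrite linearP; apply: PD.
have [L LE] := linear_of_fun lin_f; exists L => u c Pu.
by rewrite LE; apply: (P_fun u) => //; rewrite -{1}[u]pi_id //; exists c.
Qed.

(** Among the finite families in G one whose span has maximal dimension spans
    all of G. *)
Lemma finite_spanning (k : fieldType) (B : finType) (G : {ffun B -> k^o} -> Prop) :
  exists r (g : 'I_r -> {ffun B -> k^o}), (forall i, G (g i)) /\
    forall x, G x -> exists c : 'I_r -> k, x = \sum_i c i *: g i.
Proof.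
pose attained n := `[< exists s : seq {ffun B -> k^o},
  (forall x, x \in s -> G x) /\ \dim <<s>>%VS = n >].
have attained0 : exists n, attained n.
  by exists 0%N; apply/asboolP; exists [::]; rewrite span_nil dimv0.
have attained_le n : attained n -> (n <= \dim {: {ffun B -> k^o}})%N.
  by move=> /asboolP[s [_ <-]]; apply/dimvS/subvf.
case: (ex_maxnP attained0 attained_le) => n /asboolP[s [sG sn]] n_max.
exists (size s), (fun i => s`_i); split=> [i|x Gx]; first exact/sG/mem_nth.
suff /coord_span xs : x \in <<in_tuple s>>%VS.
  by exists (fun i => coord (in_tuple s) i x).
have sub_s : (<<s>> <= <<x :: s>>)%VS by rewrite span_cons addvSr.
have /eqP -> : <<in_tuple s>>%VS == <<x :: s>>%VS.
  rewrite eqEdim sub_s sn; apply: n_max; apply/asboolP; exists (x :: s).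
  by split=> // y; rewrite inE => /predU1P[->|/sG].
by apply: memv_span; rewrite inE eqxx.
Qed.

Section DependentProduct.
Variables (k : fieldType) (I : Type) (V : I -> lmodType k).

Definition dprod := forall i, V i.

HB.instance Definition _ := gen_eqMixin dprod.
HB.instance Definition _ := gen_choiceMixin dprod.

Definition dprod0 : dprod := fun i => 0.
Definition dprod_opp (u : dprod) : dprod := fun i => - u i.
Definition dprod_add (u v : dprod) : dprod := fun i => u i + v i.

Fact dprod_addA : associative dprod_add.
Proof. by move=> u v w; apply: functional_extensionality_dep => i; apply: addrA. Qed.
Fact dprod_addC : commutative dprod_add.
Proof. by move=> u v; apply: functional_extensionality_dep => i; apply: addrC. Qed.
Fact dprod_add0 : left_id dprod0 dprod_add.
Proof. by move=> u; apply: functional_extensionality_dep => i; apply: add0r. Qed.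
Fact dprod_addN : left_inverse dprod0 dprod_opp dprod_add.
Proof. by move=> u; apply: functional_extensionality_dep => i; apply: addNr. Qed.

HB.instance Definition _ :=
  GRing.isZmodule.Build dprod dprod_addA dprod_addC dprod_add0 dprod_addN.

Definition dprod_scale (a : k) (u : dprod) : dprod := fun i => a *: u i.

Fact dprod_scaleA a b u : dprod_scale a (dprod_scale b u) = dprod_scale (a * b) u.
Proof. by apply: functional_extensionality_dep => i; apply: scalerA. Qed.
Fact dprod_scale1 : left_id 1 dprod_scale.
Proof. by move=> u; apply: functional_extensionality_dep => i; apply: scale1r. Qed.
Fact dprod_scaleDr : right_distributive dprod_scale +%R.
Proof. by move=> a u v; apply: functional_extensionality_dep => i; apply: scalerDr. Qed.
Fact dprod_scaleDl u : {morph dprod_scale^~ u : a b / a + b}.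
Proof. by move=> a b; apply: functional_extensionality_dep => i; apply: scalerDl. Qed.

HB.instance Definition _ := GRing.Zmodule_isLmodule.Build k dprod
  dprod_scaleA dprod_scale1 dprod_scaleDr dprod_scaleDl.

End DependentProduct.

Lemma prod_sum_dffun (R : comPzSemiRingType) (I : finType) (T : I -> finType)
    (F : forall i, T i -> R) :
  \prod_i \sum_(x : T i) F i x
  = \sum_(f : {dffun forall i, T i}) \prod_i F i (f i).
Proof.
transitivity (\prod_i \sum_(j | j \in tagged_with T i)
    untag 0 [ffun x => F i x] j).
  apply: eq_bigr => i _; rewrite -(big_tag (fun i => [ffun x => F i x])).
  by apply: eq_bigr => x _; rewrite ffunE.
rewrite (bigA_distr_big_dep (fun i => mem (tagged_with T i))).
rewrite -(@big_fprod R 0 1 *%R +%R I T (fun i => [ffun x => F i x])).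
rewrite (reindex (@fprod_of_dffun _ T)); last exact/onW_bij/fprod_of_dffun_bij.
apply: eq_bigr => f _; apply: eq_bigr => i _; rewrite ffunE.
by rewrite /fprod_of_dffun fprodE.
Qed.

(** * Monomorphisms, retracts and finite generation *)

Section ModuleTheory.
Variables (C : fincat) (k : fieldType).
Implicit Types X Y E : module C k.

Lemma nattrans_of_fun X Y (f : forall S, X S -> Y S) :
  (forall S, linear (f S)) ->
  (forall S T (h : Hom S T) x, f T (mod_map X h x) = mod_map Y h (f S x)) ->
  {g : nattrans X Y | forall S, g S =1 f S}.
Proof.
move=> lin_f nat_f; pose app S := sval (linear_of_fun (lin_f S)).
have appE S : app S =1 f S by exact: svalP (linear_of_fun (lin_f S)).
suff nat_app S T (h : Hom S T) x : app T (mod_map X h x) = mod_map Y h (app S x).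
  by exists (NatTrans nat_app) => S; apply: appE.
by rewrite !appE nat_f.
Qed.

Definition nt_id X : nattrans X X :=
  @NatTrans C k X X (fun S => idfun) (fun S T f x => erefl).

Lemma mod_mapZ X S T (f : Hom S T) a x : mod_map X f (a *: x) = a *: mod_map X f x.
Proof. exact: linearZ. Qed.

(** By the Yoneda lemma the modules M(S) detect elements, which is why categorical
    monomorphisms are pointwise injective. *)
Lemma yoneda X S (x : X S) :
  {g : nattrans (free_module k S) X |
    forall T v, g T v = \sum_(h : Hom S T) (v h : k) *: mod_map X h x}.
Proof.
apply: nattrans_of_fun => [T a u v|T U f v].
  rewrite scaler_sumr -big_split; apply: eq_bigr => h _.
  by rewrite !ffunE scalerDl scalerA.
rewrite linear_sum.
under eq_bigr => h _ do rewrite ffunE scaler_suml.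
rewrite (exchange_big_dep predT) //=; apply: eq_bigr => g _.
rewrite (big_pred1 (compm f g)) => [|h].
  by rewrite mod_map_comp mod_mapZ.
by rewrite /= eq_sym.
Qed.

Lemma free_basis_id_sum X S (x : X S) T (h : Hom S T) :
  \sum_(g : Hom S T) (free_basis k h g : k) *: mod_map X g x = mod_map X h x.
Proof.
rewrite (bigD1 h) //= ffunE eqxx scale1r big1 ?addr0 // => g /negPf gh.
by rewrite ffunE gh scale0r.
Qed.

Lemma mono_injective X Y (i : nattrans X Y) S : is_mono i -> injective (i S).
Proof.
move=> mono_i x y ixy; have [f fE] := yoneda x; have [g gE] := yoneda y.
have /mono_i fg : nt_eq (nt_comp i f) (nt_comp i g).
  move=> T v /=; rewrite fE gE !linear_sum; apply: eq_bigr => h _.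
  by rewrite !linearZ /= !nt_natural ixy.
have := fg S (free_basis k (idm S)).
by rewrite fE gE !free_basis_id_sum !mod_map_id.
Qed.

Lemma injective_mono X Y (i : nattrans X Y) : (forall S, injective (i S)) -> is_mono i.
Proof. by move=> inj_i Z f g fg S x; apply: (inj_i S); apply: fg. Qed.

Lemma surjective_epi X Y (p : nattrans X Y) :
  (forall S y, exists x, p S x = y) -> is_epi p.
Proof. by move=> surj_p Z f g fg S y; have [x <-] := surj_p S y; apply: fg. Qed.

Definition retract X E :=
  exists (i : nattrans X E) (p : nattrans E X), forall S x, p S (i S x) = x.

Lemma retract_trans X Y E : retract X Y -> retract Y E -> retract X E.
Proof.
move=> [i [p pi]] [j [q qj]]; exists (nt_comp j i), (nt_comp p q) => S x /=.
by rewrite qj pi.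
Qed.

Lemma injective_retract X E : retract X E -> injective_module E -> injective_module X.
Proof.
move=> [s [r rs]] injE A B i f mono_i.
have [g gE] := injE A B i (nt_comp s f) mono_i.
by exists (nt_comp r g) => S x /=; have /= -> := gE S x; rewrite rs.
Qed.

Lemma injective_mono_retract X E (i : nattrans X E) :
  injective_module X -> (forall S, injective (i S)) -> retract X E.
Proof.
move=> injX inj_i; have [p pE] := injX X E i (nt_id X) (injective_mono inj_i).
by exists i, p => S x; apply: pE.
Qed.

Lemma linear_cst0 (U W : lmodType k) : linear (fun _ : U => 0 : W).
Proof. by move=> a u v; rewrite scaler0 addr0. Qed.

Lemma injective_zero : injective_module (zero_module C k).
Proof.
move=> X Y i f _.
have [g gE] := @nattrans_of_fun Y (zero_module C k) (fun _ _ => 0)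
  (fun S => @linear_cst0 _ _) (fun S T h x => erefl).
by exists g => S x; apply/rowP => -[].
Qed.

Lemma injective_dsum X Y :
  injective_module X -> injective_module Y -> injective_module (dsum X Y).
Proof.
move=> injX injY A B i f mono_i.
have [f1 f1E] := @nattrans_of_fun A X (fun S x => (f S x).1)
  (fun S a u v => congr1 fst (linearP (f S) a u v))
  (fun S T h x => congr1 fst (nt_natural f h x)).
have [f2 f2E] := @nattrans_of_fun A Y (fun S x => (f S x).2)
  (fun S a u v => congr1 snd (linearP (f S) a u v))
  (fun S T h x => congr1 snd (nt_natural f h x)).
have [g1 g1E] := injX _ _ _ f1 mono_i; have [g2 g2E] := injY _ _ _ f2 mono_i.
have [|S T h x|g gE] := @nattrans_of_fun B (dsum X Y) (fun S y => (g1 S y, g2 S y)).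
- by move=> S a u v; rewrite !linearP.
- by rewrite !nt_natural.
exists g => S x; have /= e1 := g1E S x; have /= e2 := g2E S x.
by rewrite /= gE e1 e2 f1E f2E; case: (f S x).
Qed.

Lemma injective_free_modules (s : seq (Ob C)) :
  (forall S : Ob C, injective_module (free_module k S)) -> injective_module (free_modules k s).
Proof.
by move=> inj_free; elim: s => [|S s IH]; [apply: injective_zero | apply: injective_dsum].
Qed.

(** In a category where all M(S) are injective, so are the finitely generated
    projective modules, being retracts of finite sums of M(S). *)
Lemma projective_injective (P : module C k) :
  (forall S : Ob C, injective_module (free_module k S)) ->
  finitely_generated P -> projective_module P -> injective_module P.
Proof.
move=> inj_free [s [p surj_p]] projP.
have [i iE] := projP _ _ p (nt_id P) (surjective_epi surj_p).
apply: (injective_retract _ (injective_free_modules (s := s) inj_free)).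
by exists i, p => S x; apply: iE.
Qed.

(** A pair rather than a member of X S, so that one family can contain elements of
    various degrees. *)
Definition element X := {S : Ob C & X S}.

Definition in_span1 X (e : element X) T (x : X T) :=
  exists c : Hom (projT1 e) T -> k, x = \sum_h c h *: mod_map X h (projT2 e).

Definition generates X (I : finType) (e : I -> element X) :=
  forall T (x : X T), exists y : I -> X T,
    (forall i, in_span1 (e i) (y i)) /\ x = \sum_i y i.

Lemma generates_of_fg X :
  finitely_generated X -> exists n (e : 'I_n -> element X), generates e.
Proof.
move=> [s [p surj_p]].
suff [n [e eP]] : exists n (e : 'I_n -> element X), forall T u, exists y : 'I_n -> X T,
    (forall i, in_span1 (e i) (y i)) /\ p T u = \sum_i y i.
  by exists n, e => T x; have [u <-] := surj_p T x; apply: eP.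
move: p {surj_p}; elim: s => [|S s IH] p.
  exists 0%N, (fun i : 'I_0 => False_rect _ (notF (ltn_ord i))) => T u.
  exists (fun _ => 0); split=> [[]//|].
  by rewrite big_ord0; have -> : u = 0 by [apply/rowP; case]; rewrite linear0.
have [|T T' h x|p2 p2E] := @nattrans_of_fun (free_modules k s) X (fun T x => p T (0, x)).
- move=> T a u v; rewrite -linearP; congr (p T _).
  by apply: injective_projections; rewrite //= scaler0 addr0.
- rewrite -nt_natural /=; congr (p _ _).
  by apply: injective_projections; rewrite //= linear0.
have [n [e eP]] := IH p2.
pose e0 : element X := existT _ S (p S (free_basis k (idm S), 0)).
exists n.+1, (fun i => if unlift ord0 i is Some j then e j else e0) => T [u v].
have [y [ye vE]] := eP T v.
pose y0 := p T (u, 0).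
exists (fun i => if unlift ord0 i is Some j then y j else y0); split=> [i|].
  case: unliftP => [j|] _ //; exists u; rewrite /y0 /=.
  pose q h : (free_modules k (S :: s)) T := (free_basis k h, 0).
  have -> : (u, 0) = \sum_h (u h : k) *: q h.
    have qE (r : seq (Hom S T)) : \sum_(h <- r) (u h : k) *: q h
        = (\sum_(h <- r) (u h : k) *: free_basis k h, 0).
      elim: r => [|h r IHr]; first by rewrite !big_nil.
      rewrite !big_cons IHr; apply: injective_projections => //=.
      by rewrite scaler0 addr0.
    rewrite qE; congr (_, _); apply/ffunP => h; rewrite sum_ffunE.
    rewrite (bigD1 h) //= !ffunE eqxx big1 ?addr0 => [|g /negPf gh].
      by rewrite [RHS]mulr1.
    by rewrite !ffunE eq_sym gh scaler0.
  rewrite linear_sum; apply: eq_bigr => h _; rewrite linearZ /e0 /=.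
  congr (_ *: _); rewrite -(nt_natural p) /= /dsum_map_fun /= free_map_basis compm1.
  by rewrite linear0.
rewrite big_ord_recl unlift_none; under eq_bigr do rewrite liftK.
rewrite -vE p2E /y0 -linearD; congr (p T _).
by apply: injective_projections; rewrite /= ?addr0 ?add0r.
Qed.

Lemma fg_of_generates X (I : finType) (e : I -> element X) :
  generates e -> finitely_generated X.
Proof.
move=> gen_e.
have partial : forall r : seq I, exists p : nattrans
    (free_modules k [seq projT1 (e i) | i <- r]) X,
    forall T (y : I -> X T), (forall i, in_span1 (e i) (y i)) ->
    exists u, p T u = \sum_(i <- r) y i.
  elim=> [|i r [p pP]].
    have [p pE] := @nattrans_of_fun (zero_module C k) X (fun _ _ => 0)
      (fun S => @linear_cst0 _ _)
      (fun S T h x => esym (linear0 _)).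
    by exists p => T y _; exists 0; rewrite big_nil linear0.
  have [q qE] := yoneda (projT2 (e i)).
  have [|S T h [u v]|g gE] := @nattrans_of_fun
      (free_modules k [seq projT1 (e i) | i <- i :: r]) X
      (fun T uv => q T uv.1 + p T uv.2).
  - by move=> T a u v; rewrite /= !linearP /= scalerDr addrACA.
  - by rewrite /= !nt_natural linearD.
  exists g => T y ye; have [v vE] := pP T y ye; have [c cE] := ye i.
  exists (finfun (fun h => c h : k^o), v); rewrite gE big_cons vE; congr (_ + _).
  by rewrite qE cE; apply: eq_bigr => h _; rewrite ffunE.
have [q qP] := partial (enum I).
exists [seq projT1 (e i) | i <- enum I], q => T x.
have [y [ye ->]] := gen_e T x; have [u uE] := qP T y ye.
by exists u; rewrite uE big_enum.
Qed.

Lemma free_module_fg (S : Ob C) : finitely_generated (free_module k S).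
Proof.
apply: (@fg_of_generates (free_module k S) unit
  (fun=> existT _ S (free_basis k (idm S)))).
move=> T x; exists (fun=> x); split=> [_|]; last by rewrite big_const card_unit /= addr0.
exists (fun h => x h : k); rewrite /=.
apply/ffunP => h; rewrite sum_ffunE (bigD1 h) //= free_map_basis compm1 !ffunE.
rewrite eqxx big1 ?addr0 => [|g /negPf gh]; first by rewrite [RHS]mulr1.
by rewrite free_map_basis compm1 !ffunE eq_sym gh scaler0.
Qed.

Lemma generates_eq X (I : finType) (e : I -> element X) Y (f g : nattrans X Y) :
  generates e -> (forall i, f _ (projT2 (e i)) = g _ (projT2 (e i))) -> nt_eq f g.
Proof.
move=> gen_e fg T x; have [y [ye ->]] := gen_e T x.
rewrite !linear_sum; apply: eq_bigr => i _; have [c ->] := ye i.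
by rewrite !linear_sum; apply: eq_bigr => h _; rewrite !linearZ /= !nt_natural fg.
Qed.

End ModuleTheory.

(** * Function modules of presheaves of finite sets *)

Record presheaf (C : fincat) := Presheaf {
  ps_obj :> Ob C -> finType;
  res : forall S T, Hom S T -> ps_obj T -> ps_obj S;
  res_id : forall S z, res (idm S) z = z;
  res_comp : forall S T U (g : Hom T U) (f : Hom S T) z,
    res (compm g f) z = res f (res g z)
}.

Section FunctionModule.
Variables (C : fincat) (k : fieldType) (Z : presheaf C).

Definition cofun_obj (T : Ob C) : lmodType k := {ffun Z T -> k^o}.

Section Map.
Variables (S T : Ob C) (f : Hom S T).

Definition cofun_map_fun (phi : cofun_obj S) : cofun_obj T :=
  [ffun z => phi (res f z)].

Fact cofun_map_linear : linear cofun_map_fun.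
Proof. by move=> a u v; apply/ffunP => z; rewrite !ffunE. Qed.

HB.instance Definition _ := GRing.isLinear.Build k (cofun_obj S) (cofun_obj T) _
  cofun_map_fun cofun_map_linear.

Definition cofun_map : {linear cofun_obj S -> cofun_obj T} := cofun_map_fun.

Lemma cofun_mapE phi z : cofun_map phi z = phi (res f z).
Proof. exact: ffunE. Qed.

End Map.

Fact cofun_map_id T x : cofun_map (idm T) x = x.
Proof. by apply/ffunP => z; rewrite cofun_mapE res_id. Qed.

Fact cofun_map_comp T U R (g : Hom U R) (f : Hom T U) x :
  cofun_map (compm g f) x = cofun_map g (cofun_map f x).
Proof. by apply/ffunP => z; rewrite !cofun_mapE res_comp. Qed.

Definition cofun : module C k := Module cofun_map_id cofun_map_comp.

End FunctionModule.

(** * Averaging *)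

(** A morphism from X to [cofun k Z] is a linear functional on the colimit of X
    over the category of elements of Z, so [cofun k Z] is injective when that
    colimit is an exact functor of X. The following data guarantee exactness.
    The category of elements is a union of parts indexed by [label]; in the part
    j there is a sequence of objects ([target] j n, [tpoint] j n), and an element
    (T, z) of this part is sent to the n-th one by the formal average
    [weight] j n z of morphisms, provided that n is large enough. These averages
    are compatible with all morphisms, and thus replace the colimit by the colimit
    of a sequence. *)
Record averaging (C : fincat) (k : fieldType) (Z : presheaf C) := Averaging {
  label : Type;
  lab : forall T, Z T -> label;
  target : label -> nat -> Ob C;
  tpoint : forall j n, Z (target j n);
  weight : forall j n T, Z T -> Hom T (target j n) -> k;
  good : forall j (n : nat) T, Z T -> Prop;
  lab_res : forall S T (f : Hom S T) z, lab (res f z) = lab z;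
  good_eventually : forall T (z : Z T),
    exists N, forall n, (N <= n)%N -> good (lab z) n z;
  weight_sum : forall j n T (z : Z T), good j n z ->
    \sum_h @weight j n T z h = 1;
  weight_supp : forall j n T (z : Z T) h, @weight j n T z h != 0 ->
    res h (tpoint j n) = z;
  weight_res : forall j n S T (f : Hom S T) (z : Z T) h, good j n z ->
    \sum_(g | compm g f == h) @weight j n T z g = @weight j n S (res f z) h
}.

Arguments weight {C k Z} a j n {T} z h.
Arguments target {C k Z} a j n.
Arguments tpoint {C k Z} a j n.
Arguments good {C k Z} a j n {T} z.
Arguments lab {C k Z} a {T} z.

Definition eventually0 (k : fieldType) (V : nat -> lmodType k) (w : dprod V) :=
  exists N, forall n, (N <= n)%N -> w n = 0.

Lemma eventually0_subspace (k : fieldType) (V : nat -> lmodType k) :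
  subspace (@eventually0 k V).
Proof.
split=> [|a u v [N uN] [M vM]]; first by exists 0%N.
exists (maxn N M) => n; rewrite geq_max => /andP[Nn Mn].
have -> : (a *: u + v) n = a *: u n + v n by [].
by rewrite uN // vM // scaler0 addr0.
Qed.

Section Averages.
Variables (C : fincat) (k : fieldType) (Z : presheaf C) (A : averaging k Z).
Implicit Types X Y : module C k.

Definition avg X j n T (z : Z T) (x : X T) : X (target A j n) :=
  \sum_h weight A j n z h *: mod_map X h x.

Arguments avg {X} j n {T} z x.

Lemma avg_linear X j n T (z : Z T) : linear (@avg X j n T z).
Proof.
move=> a u v; rewrite /avg scaler_sumr -big_split; apply: eq_bigr => h _.
by rewrite linearP scalerDr !scalerA mulrC.
Qed.

HB.instance Definition _ X j n T z := GRing.isLinear.Build k (X T)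
  (X (target A j n)) _ (@avg X j n T z) (@avg_linear X j n T z).

Lemma avg_res X j n S T (f : Hom S T) (z : Z T) (x : X S) : good A j n z ->
  avg j n z (mod_map X f x) = avg j n (res f z) x.
Proof.
move=> gz; rewrite /avg (partition_big (fun g => compm g f) predT) //=.
apply: eq_bigr => h _; rewrite -weight_res // scaler_suml.
by apply: eq_bigr => g /eqP <-; rewrite mod_map_comp.
Qed.

Lemma avg_nat X Y (f : nattrans X Y) j n T (z : Z T) (x : X T) :
  f _ (avg j n z x) = avg j n z (f _ x).
Proof.
rewrite /avg linear_sum; apply: eq_bigr => h _.
by rewrite linearZ /= nt_natural.
Qed.

Lemma avg_cofun j n T (z : Z T) (phi : cofun k Z T) : good A j n z ->
  avg j n z phi (tpoint A j n) = phi z.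
Proof.
move=> gz; rewrite /avg sum_ffunE -[phi z]mul1r -(weight_sum gz) mulr_suml.
apply: eq_bigr => h _; rewrite !ffunE.
have [->|w0] := eqVneq (weight A j n z h) 0; first by rewrite scale0r mul0r.
by rewrite (weight_supp w0).
Qed.

(** A functional on sequences that ignores finitely many terms amounts to a
    functional on the colimit: averages are compatible with morphisms as soon as
    n is large. *)
Lemma nattrans_of_functionals X
    (L : forall j, {linear dprod (fun n => X (target A j n)) -> k^o}) :
  (forall j w, eventually0 w -> L j w = 0) ->
  exists g : nattrans X (cofun k Z), forall T x z,
    g T x z = L (lab A z) (fun n => avg (lab A z) n z x).
Proof.
move=> L0; have [|S T h x|g gE] := @nattrans_of_fun C k X (cofun k Z)
  (fun T x => [ffun z => L (lab A z) (fun n => avg (lab A z) n z x)]).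
- move=> T a u v; apply/ffunP => z; rewrite !ffunE -linearP; congr (L _ _).
  by apply: functional_extensionality_dep => n; apply: linearP.
- apply/ffunP => z; rewrite !ffunE lab_res; apply/eqP.
  rewrite -subr_eq0 -linearB; apply/eqP/L0.
  have [N goodN] := good_eventually A z; exists N => n /goodN gz.
  by apply/eqP; rewrite subr_eq0; apply/eqP/avg_res.
by exists g => T x z; rewrite gE ffunE.
Qed.

(** Averages turn an extension problem for morphisms into one for functionals
    on sequences. The functional to be extended is determined on the sequences
    that eventually come from X; it is well defined because X is a submodule of
    Y, and this is where the monomorphism is used. *)
Theorem cofun_injective : injective_module (cofun k Z).
Proof.
move=> X Y i f mono_i; have inj_i := mono_injective mono_i.
pose P j (w : dprod (fun n => Y (target A j n))) (c : k) := exists N, forall n,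
  (N <= n)%N -> exists x, w n = i _ x /\ f _ x (tpoint A j n) = c.
have [L LP] : exists L : forall j, {linear dprod (fun n => Y (target A j n)) -> k^o},
    forall j w c, P j w c -> L j w = c.
  suff ex_L j : exists L : {linear dprod (fun n => Y (target A j n)) -> k^o},
      forall w c, P j w c -> L w = c.
    by exists (fun j => projT1 (cid (ex_L j))) => j; apply: projT2 (cid (ex_L j)).
  apply: functional_extension => [|a u v c e [N uN] [M vM]|c [N zN]].
  - by exists 0%N => n _; exists 0; rewrite !linear0 ffunE.
  - exists (maxn N M) => n; rewrite geq_max => /andP[/uN[x [ux xc]] /vM[y [vy ye]]].
    exists (a *: x + y); rewrite !linearP !ffunE -ux -vy xc ye; split=> //.
  - have [x [x0 <-]] := zN N (leqnn N).
    have -> : x = 0 by apply: inj_i; rewrite -x0 linear0.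
    by rewrite linear0 ffunE.
have [j w [N wN]|g gE] := @nattrans_of_functionals Y L.
  apply: LP; exists N => n /wN ->; exists 0; by rewrite !linear0 ffunE.
exists g => T x /=; apply/ffunP => z; rewrite gE; apply: LP.
have [N goodN] := good_eventually A z; exists N => n /goodN gz.
exists (avg (lab A z) n z x); split; first by rewrite avg_nat.
by rewrite avg_nat avg_cofun.
Qed.

(** The same extension of functionals, now from the line spanned by the
    sequence of averages of v. *)
Lemma cofun_separates X T (v : X T) (z : Z T) :
  ~ eventually0 (fun n => avg (lab A z) n z v) ->
  exists g : nattrans X (cofun k Z), g T v z != 0.
Proof.
set j := lab A z; pose s : dprod (fun n => X (target A j n)) := fun n => avg j n z v.
move=> nv0; have {}nv0 : ~ eventually0 s by [].
pose P (w : dprod (fun n => X (target A j n))) (c : k) :=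
  eventually0 (w - c *: s).
have ev0 := eventually0_subspace (fun n => X (target A j n)).
have [||c Pc|L LP] := @functional_extension k _ P.
- by rewrite /P scale0r subr0; apply: subspace0 ev0.
- move=> a u w c e Pu Pw; rewrite /P scalerDl opprD addrACA -scalerA -scalerBr.
  exact: subspaceP.
- apply: contrapT => /eqP c0; apply: nv0.
  have -> : s = - c^-1 *: (0 - c *: s).
    by rewrite sub0r scalerN scaleNr opprK scalerA mulVf // scale1r.
  exact: subspaceZ.
(* Zero on the parts other than that of z. *)
pose L' i : {linear dprod (fun n => X (target A i n)) -> k^o} :=
  if pselect (j = i) is left e then ecast i {linear dprod (fun n => X (target A i n)) -> k^o} e L
  else \0.
have [i w w0|g gE] := @nattrans_of_functionals X L'.
  rewrite /L'; case: pselect => // e; case: _ / e w w0 => w w0 /=.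
  by apply: LP; rewrite /P scale0r subr0.
exists g; rewrite gE -/j /L'; case: pselect => // e.
rewrite (Prop_irrelevance e erefl) /= (LP _ 1) ?oner_eq0 // /P scale1r subrr.
exact: subspace0 ev0.
Qed.

End Averages.

(** * Averaging data for representables, coproducts and external products *)

Section Representable.
Variables (C : fincat) (k : fieldType) (R : Ob C).

Definition representable : presheaf C :=
  @Presheaf C (fun T => Hom T R) (fun S T f z => compm z f)
    (fun S z => compm1 z) (fun S T U g f z => compmA z g f).

Lemma representable_pushforward S T (f : Hom S T) (z : Hom T R) (h : Hom S R) :
  \sum_(g | compm g f == h) (g == z)%:R = (h == compm z f)%:R :> k.
Proof.
have [->|hz] := eqVneq h (compm z f).
  by rewrite (bigD1 z) //= eqxx big1 ?addr0 // => g /andP[_ /negPf ->].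
rewrite big1 // => g /eqP gh; case: eqVneq => // gz.
by rewrite -gh gz eqxx in hz.
Qed.

Definition representable_averaging : averaging k representable.
Proof.
apply: (@Averaging C k representable unit (fun _ _ => tt) (fun _ _ => R)
  (fun _ _ => idm R) (fun _ _ T z h => (h == z)%:R) (fun _ _ _ _ => True)).
- by [].
- by move=> T z; exists 0%N.
- move=> _ _ T z _; rewrite (bigD1 z) //= eqxx big1 ?addr0 // => h hz.
  by rewrite (negPf hz).
- by move=> _ _ T z h /=; case: (eqVneq h z) => [->|]; rewrite ?comp1m ?eqxx.
- by move=> _ _ S T f z h _; apply: representable_pushforward.
Defined.

Lemma representable_avg (X : module C k) n T (z : representable T) (x : X T) :
  avg (A := representable_averaging) tt n z x = mod_map X z x.
Proof.
rewrite /avg /= (bigD1 z) //= eqxx scale1r big1 ?addr0 // => h /negPf ->.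
by rewrite scale0r.
Qed.

End Representable.

Section Coproduct.
Variables (C : fincat) (k : fieldType) (I : finType) (Z : I -> presheaf C).

Definition coprod : presheaf C.
Proof.
apply: (@Presheaf C (fun T => {i : I & Z i T})
  (fun S T f z => Tagged (fun i => Z i S) (res f (tagged z)))).
- by move=> S [i z]; rewrite res_id.
- by move=> S T U g f [i z]; rewrite res_comp.
Defined.

(** The part of label (i, j) meets the summand i only, so its weights are put equal
    to 0 on the other summands. *)
Definition coprod_averaging (A : forall i, averaging k (Z i)) : averaging k coprod.
Proof.
apply: (@Averaging C k coprod {i : I & label (A i)}
  (fun T z => Tagged (fun i => label (A i)) (lab (A (tag z)) (tagged z)))
  (fun j n => target (A (tag j)) (tagged j) n)
  (fun j n => Tagged (fun i => Z i _) (tpoint (A (tag j)) (tagged j) n))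
  (fun j n T z h => untag 0 (fun z : Z (tag j) T =>
     weight (A (tag j)) (tagged j) n z h) z)
  (fun j n T z => untag False (fun z : Z (tag j) T =>
     good (A (tag j)) (tagged j) n z) z)).
- by move=> S T f [i z] /=; rewrite lab_res.
- move=> T [i z] /=; have [N goodN] := good_eventually (A i) z.
  by exists N => n /goodN; rewrite untagE.
- move=> [i j] n T [i' z] /=; have [e|ne] := eqVneq i' i; last first.
    by rewrite untag_dflt.
  case: _ / e j => j; rewrite untagE => gz.
  by under eq_bigr do rewrite untagE; apply: weight_sum.
- move=> [i j] n T [i' z] h /=; have [e|ne] := eqVneq i' i; last first.
    by rewrite untag_dflt // eqxx.
  by case: _ / e j h => j h; rewrite untagE => /weight_supp ->.
- move=> [i j] n S T f [i' z] h /=; have [e|ne] := eqVneq i' i; last first.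
    by rewrite untag_dflt.
  case: _ / e j h => j h; rewrite !untagE => gz; rewrite -weight_res //.
  by apply: eq_bigr => g _; rewrite untagE.
Defined.

Lemma coprod_avg (A : forall i, averaging k (Z i)) (X : module C k) i j n T
    (z : Z i T) (x : X T) :
  avg (A := coprod_averaging A) (Tagged (fun i => label (A i)) j) n
    (Tagged (fun i => Z i T) z) x = avg (A := A i) j n z x.
Proof. by apply: eq_bigr => h _; rewrite /= untagE. Qed.

End Coproduct.

(** Averages over a product of categories are iterated, whence products of weights. *)
Section ExternalProduct.
Variables (C : fincat) (k : fieldType) (m : nat) (Z : 'I_m -> presheaf C).

Definition ext_prod : presheaf (pow_cat C m).
Proof.
apply: (@Presheaf (pow_cat C m) (fun T => {dffun forall i, Z i (T i)})
  (fun S T f z => [ffun i => res (f i) (z i)])).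
- by move=> S z; apply/ffunP => i; rewrite !ffunE res_id.
- by move=> S T U g f z; apply/ffunP => i; rewrite !ffunE res_comp.
Defined.

Definition ext_prod_averaging (A : forall i, averaging k (Z i)) :
  averaging k ext_prod.
Proof.
apply: (@Averaging (pow_cat C m) k ext_prod (forall i, label (A i))
  (fun T z i => lab (A i) (z i)) (fun j n i => target (A i) (j i) n)
  (fun j n => [ffun i => tpoint (A i) (j i) n])
  (fun j n T z h => \prod_i weight (A i) (j i) n (z i) (h i))
  (fun j n T z => forall i, good (A i) (j i) n (z i))).
- move=> S T f z; apply: functional_extensionality_dep => i.
  by rewrite ffunE lab_res.
- move=> T z; pose N i := projT1 (cid (good_eventually (A i) (z i))).
  have NP i := projT2 (cid (good_eventually (A i) (z i))).
  exists (\max_i N i) => n Nn i; apply: NP.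
  exact: leq_trans (leq_bigmax i) Nn.
- move=> j n T z gz.
  rewrite -(prod_sum_dffun (fun i h => weight (A i) (j i) n (z i) h)) big1 // => i _.
  exact: weight_sum.
- move=> j n T z h /prodf_neq0 w0; apply/ffunP => i; rewrite !ffunE.
  exact/weight_supp/w0.
- move=> j n S T f z h gz.
  under [RHS]eq_bigr => i _ do rewrite ffunE -(weight_res _ _ (gz i)) big_mkcond.
  rewrite prod_sum_dffun big_mkcond; apply: eq_bigr => g _.
  case: eqVneq => [<-|ne].
    by apply: eq_bigr => i _; rewrite ffunE eqxx.
  have /existsP[i gi] : [exists i, compm (g i) (f i) != h i].
    rewrite -negb_forall; apply: contra ne => /forallP gf.
    by apply/eqP/ffunP => i; rewrite ffunE; apply/eqP.
  by rewrite (bigD1 i) //= (negPf gi) mul0r.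
Defined.

End ExternalProduct.

(** * Embedding finitely generated modules into function modules *)

Section FinitelyGenerated.
Variables (C : fincat) (k : fieldType) (X : module C k).
Variables (n : nat) (e : 'I_n -> element X).
Hypothesis gen_e : generates e.
Variable Z : presheaf C.

(** Morphisms from X to [cofun k Z] are determined by their values at the
    generators, so they form a space of finite dimension and finitely many of
    them separate what all of them separate. *)
Lemma cofun_embedding :
  (forall T (v : X T), v <> 0 ->
     exists (g : nattrans X (cofun k Z)) z, g T v z != 0) ->
  exists r (f : nattrans X (cofun k (coprod (fun _ : 'I_r => Z)))),
    forall T, injective (f T).
Proof.
move=> sep; pose B : finType := {i : 'I_n & Z (projT1 (e i))}.
pose value (g : nattrans X (cofun k Z)) : {ffun B -> k^o} :=
  [ffun b => g _ (projT2 (e (tag b))) (tagged b)].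
have [r [w [wG w_span]]] := @finite_spanning k B (fun x => exists g, x = value g).
have [g gw] := choice wG.
pose F T (x : X T) : cofun k (coprod (fun _ : 'I_r => Z)) T :=
  [ffun z : coprod (fun _ => Z) T => g (tag z) T x (tagged z)].
have [|S T h x|f fE] := @nattrans_of_fun C k X (cofun k (coprod (fun _ : 'I_r => Z))) F.
- by move=> T a u v; apply/ffunP => z; rewrite !ffunE linearP !ffunE.
- by apply/ffunP => z; rewrite !ffunE nt_natural cofun_mapE.
exists r, f => T x y fxy; apply/eqP; rewrite -subr_eq0; apply/eqP.
apply: contrapT => /sep[g' [z]].
have [|c cE] := w_span (value g'); first by exists g'.
have [|S T' h u|g'' g''E] := @nattrans_of_fun C k X (cofun k Z)
  (fun T x => \sum_i c i *: g i T x).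
- move=> S a u v; rewrite scaler_sumr -big_split; apply: eq_bigr => i _.
  by rewrite linearP scalerDr !scalerA mulrC.
- by rewrite linear_sum; apply: eq_bigr => i _; rewrite linearZ /= nt_natural.
have -> : g' T (x - y) = g'' T (x - y).
  apply: (generates_eq gen_e) => i; apply/ffunP => b; rewrite g''E.
  have := congr1 (fun v : {ffun B -> k^o} => v (existT _ i b)) cE.
  rewrite !ffunE sum_ffunE => ->; rewrite sum_ffunE.
  by apply: eq_bigr => l _; rewrite !ffunE gw ffunE.
rewrite g''E sum_ffunE big1 ?eqxx // => i _; rewrite ffunE linearB !ffunE.
have := congr1 (fun v : {ffun _ -> k^o} => v (existT (fun _ : 'I_r => Z T) i z)) fxy.
by rewrite /= !fE !ffunE /= => ->; rewrite subrr scaler0.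
Qed.

(** Averages of elements of X are combinations of the averages of the generators,
    with coefficients independent of n, so the relations between the latter at
    infinity, having a finite basis, all hold at a finite stage. This bounds the
    degree of torsion without an appeal to noetherianity. *)
Lemma avg_eq0_stable (A : averaging k Z) (j : label A) :
  (forall T (z : Z T), lab A z = j) ->
  exists n1, forall N T (z : Z T) (v : X T), (n1 <= N)%N -> good A j N z ->
    eventually0 (fun N => avg (A := A) j N z v) -> avg (A := A) j N z v = 0.
Proof.
move=> lab_j; pose B : finType := {i : 'I_n & Z (projT1 (e i))}.
pose rel N (c : {ffun B -> k^o}) :=
  \sum_b (c b : k) *: avg (A := A) j N (tagged b) (projT2 (e (tag b))) = 0.
have [r [w [wG w_span]]] := @finite_spanning k B
  (fun c => exists N0, forall N, (N0 <= N)%N -> rel N c).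
have [M wM] := choice wG; exists (\max_i M i) => N T z v MN gz [N0 v0].
have [y [ye vE]] := gen_e v.
have [c yc] : exists c : forall i, Hom (projT1 (e i)) T -> k,
    forall i, y i = \sum_h c i h *: mod_map X h (projT2 (e i)).
  by exists (fun i => projT1 (cid (ye i))) => i; apply: projT2 (cid (ye i)).
(* Each h moves z to some element over a generator: collect coefficients. *)
pose d : {ffun B -> k^o} := [ffun b => \sum_(h | res h z == tagged b) c (tag b) h].
have avgE N' : good A j N' z -> avg (A := A) j N' z v =
    \sum_b (d b : k) *: avg (A := A) j N' (tagged b) (projT2 (e (tag b))).
  move=> gz'; rewrite vE linear_sum /=; transitivity (\sum_i \sum_(b : Z (projT1 (e i)))
      (\sum_(h | res h z == b) c i h) *: avg (A := A) j N' b (projT2 (e i))).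
    apply: eq_bigr => i _; rewrite yc linear_sum /=.
    rewrite (partition_big (fun h => res h z) predT) //=.
    apply: eq_bigr => b _; rewrite scaler_suml; apply: eq_bigr => h /eqP <-.
    by rewrite linearZ /= avg_res.
  by rewrite sig_big_dep /=; apply: eq_bigr => b _; rewrite ffunE.
rewrite avgE //; have [|a ->] := w_span d.
  have [N1 good1] := good_eventually A z; rewrite lab_j in good1.
  exists (maxn N0 N1) => N'; rewrite geq_max => /andP[N0' /good1 gz'].
  by rewrite /rel -avgE // v0.
transitivity (\sum_i a i *: \sum_b (w i b : k)
    *: avg (A := A) j N (tagged b) (projT2 (e (tag b)))).
  under [RHS]eq_bigr => i _ do rewrite scaler_sumr.
  rewrite exchange_big; apply: eq_bigr => b _ /=; rewrite sum_ffunE scaler_suml.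
  by apply: eq_bigr => i _; rewrite ffunE scalerA.
rewrite big1 // => i _; rewrite (wM i) ?scaler0 //.
exact: leq_trans (leq_bigmax i) MN.
Qed.

End FinitelyGenerated.

(** * Partial injections and their averages *)

(** Transpositions repair the places where f and g differ one at a time, and
    each of them exchanges two points at which zeta takes the same value. *)
Lemma perm_extension (S O : finType) (R : Type) (zeta : O -> R) (f g : S -> O) :
  injective f -> injective g -> (forall x, zeta (f x) = zeta (g x)) ->
  exists s : {perm O}, (forall x, s (f x) = g x) /\ forall y, zeta (s y) = zeta y.
Proof.
move=> inj_f inj_g.
have [n] := ubnP #|[pred x | f x != g x]|; elim: n f inj_f => // n IH f inj_f lt_n zfg.
have [x /= fgx|fg] := pickP [pred x | f x != g x]; last first.
  by exists 1%g; split=> [x|y]; rewrite perm1 //; apply/eqP/negbFE/fg.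
pose t := tperm (f x) (g x).
have zt y : zeta (t y) = zeta y by rewrite /t; case: tpermP => [->|->|].
have [|||s [sf zs]] := IH (t \o f).
- exact: inj_comp perm_inj inj_f.
- rewrite ltnS in lt_n; apply: leq_trans lt_n; apply: proper_card; apply/properP; split.
    apply/subsetP => y; rewrite !inE; apply: contra => /eqP fgy /=.
    by rewrite fgy tpermD ?(inj_eq inj_g) -?fgy ?(inj_eq inj_f) //;
      apply: contraNneq fgx => ->; rewrite fgy.
  by exists x; rewrite !inE //= tpermL eqxx.
- by move=> y; rewrite /= zt.
by exists (t * s)%g; split=> y; rewrite permM ?zs ?zt //; apply: sf.
Qed.

Lemma sum_nat_pred (T : finType) (Q P : pred T) :
  (\sum_(x | Q x) P x)%N = #|[set x | P x & Q x]|.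
Proof.
rewrite -sum1dep_card big_mkcond [RHS]big_mkcond; apply: eq_bigr => x _.
by case: (P x); case: (Q x).
Qed.

Lemma injection_exists (S T : finType) :
  (#|S| <= #|T|)%N -> exists f : S -> T, injective f.
Proof.
move=> le_ST; exists (fun x => enum_val (widen_ord le_ST (enum_rank x))) => x y.
by move=> /enum_val_inj/(congr1 val)/= /ord_inj/enum_rank_inj.
Qed.

Lemma FI_compE (S T U : finType) (g : FI_hom T U) (f : FI_hom S T) x :
  FI_fun (FI_comp g f) x = FI_fun g (FI_fun f x).
Proof. by rewrite FI_mkE. Qed.

Definition FI_perm (T : finType) (s : {perm T}) : FI_hom T T := FI_mk (@perm_inj T s).

Lemma FI_permE (T : finType) (s : {perm T}) x : FI_fun (FI_perm s) x = s x.
Proof. by rewrite FI_mkE. Qed.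

Lemma FI_permM (T : finType) (s t : {perm T}) :
  FI_perm (s * t) = FI_comp (FI_perm t) (FI_perm s).
Proof. by apply: FI_homP => x; rewrite FI_compE !FI_permE permM. Qed.

Lemma FI_perm1 (T : finType) : FI_perm (1 : {perm T}) = FI_id T.
Proof. by apply: FI_homP => x; rewrite FI_permE perm1 FI_mkE. Qed.

Lemma FI_permK (S T : finType) (s : {perm T}) :
  cancel (@FI_comp S T T (FI_perm s)) (FI_comp (FI_perm s^-1)).
Proof. by move=> f; apply: FI_homP => x; rewrite !FI_compE !FI_permE permK. Qed.

Lemma FI_permKV (S T : finType) (s : {perm T}) :
  cancel (@FI_comp S T T (FI_perm s^-1)) (FI_comp (FI_perm s)).
Proof. by move=> f; apply: FI_homP => x; rewrite !FI_compE !FI_permE permKV. Qed.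

Section PartialInjections.
Variable D : finType.

Definition partial_injective (T : finType) (z : {ffun T -> option D}) :=
  [forall x, forall y, (z x != None) && (z x == z y) ==> (x == y)].

Lemma partial_injectiveP (T : finType) (z : {ffun T -> option D}) :
  reflect (forall x y, z x <> None -> z x = z y -> x = y) (partial_injective z).
Proof.
apply: (iffP idP) => [/forallP zP x y /eqP zx /eqP zxy|zP].
  by have /forallP/(_ y) := zP x; rewrite zx zxy => /eqP.
apply/forallP => x; apply/forallP => y; apply/implyP => /andP[/eqP zx /eqP zxy].
exact/eqP/zP.
Qed.

Definition partial_injection (T : finType) : finType :=
  {z : {ffun T -> option D} | partial_injective z}.

Fact pinj_res_subproof (S T : finType) (f : FI_hom S T) (z : partial_injection T) :
  partial_injective [ffun x => val z (FI_fun f x)].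
Proof.
apply/partial_injectiveP => x y; rewrite !ffunE => zx zxy.
by apply: (@FI_inj _ _ f); have /partial_injectiveP zP := valP z; apply: zP.
Qed.

Definition pinj_res (S T : finType) (f : FI_hom S T) (z : partial_injection T) :
  partial_injection S := exist _ [ffun x => val z (FI_fun f x)] (pinj_res_subproof f z).

Lemma pinj_resE (S T : finType) (f : FI_hom S T) (z : partial_injection T) x :
  val (pinj_res f z) x = val z (FI_fun f x).
Proof. exact: ffunE. Qed.

Lemma pinj_eqP (T : finType) (z w : partial_injection T) : val z =1 val w -> z = w.
Proof. by move=> zw; apply/val_inj/ffunP. Qed.

(** A partial injection to D is an orbit of injections to the union of D and an
    infinite set under the permutations of the latter. *)
Definition pinj : presheaf FI.
Proof.
apply: (@Presheaf FI partial_injection pinj_res) => [S z|S T U g f z];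
  apply: pinj_eqP => x; rewrite !pinj_resE.
  by rewrite /= FI_mkE.
by rewrite FI_compE.
Defined.

(** A finite stage of that union. *)
Definition thick (n : nat) : finType := (D + 'I_n)%type.

Definition thick_type n (y : thick n) : option D := if y is inl d then Some d else None.

Fact thick_point_subproof n : partial_injective [ffun y => @thick_type n y].
Proof. by apply/partial_injectiveP => -[d|i] [d'|i']; rewrite !ffunE //= => _ [->]. Qed.

Definition thick_point n : partial_injection (thick n) :=
  exist _ [ffun y => thick_type y] (thick_point_subproof n).

Definition has_type n T (z : partial_injection T) (h : FI_hom T (thick n)) :=
  pinj_res h (thick_point n) == z.

Lemma has_typeP n T (z : partial_injection T) (h : FI_hom T (thick n)) :
  reflect (forall x, thick_type (FI_fun h x) = val z x) (has_type z h).
Proof.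
apply: (iffP eqP) => [<- x|hz].
  by rewrite pinj_resE ffunE.
by apply: pinj_eqP => x; rewrite pinj_resE ffunE.
Qed.

Lemma has_type_exists n (T : finType) (z : partial_injection T) :
  (#|T| <= n)%N -> exists h : FI_hom T (thick n), has_type z h.
Proof.
move=> le_Tn; have [|f inj_f] := @injection_exists T 'I_n; first by rewrite card_ord.
have inj_h : injective (fun x => if val z x is Some d then inl d else inr (f x) : thick n).
  move=> x y; have /partial_injectiveP zP := valP z.
  case zx : (val z x) => [d|]; case zy : (val z y) => [d'|] //=.
    by move=> [dd']; apply: zP; rewrite zx // zy dd'.
  by move=> [] /inj_f.
exists (FI_mk inj_h); apply/has_typeP => x; rewrite FI_mkE.
by case: (val z x).
Qed.

Lemma has_type_comp n S T (f : FI_hom S T) (z : partial_injection T)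
    (h : FI_hom T (thick n)) :
  has_type z h -> has_type (pinj_res f z) (FI_comp h f).
Proof. by move=> /has_typeP hz; apply/has_typeP => x; rewrite FI_compE hz pinj_resE. Qed.

(** Permutations of the added points are transitive on the extensions h of a
    given type, and so all h extend to the same number of g. *)
Lemma card_extensions n S T (f : FI_hom S T) (z : partial_injection T)
    (h h' : FI_hom S (thick n)) :
  has_type (pinj_res f z) h -> has_type (pinj_res f z) h' ->
  #|[set g | has_type z g & FI_comp g f == h]|
  = #|[set g | has_type z g & FI_comp g f == h']|.
Proof.
move=> /has_typeP hz /has_typeP h'z.
have [|s [sh zs]] := perm_extension (zeta := @thick_type n) (@FI_inj _ _ h) (@FI_inj _ _ h').
  by move=> x; rewrite hz h'z.
rewrite -(card_imset _ (can_inj (@FI_permK T _ s))); congr #|pred_of_set _|.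
apply/setP => g; apply/imsetP/idP => [[g' + ->]|].
  rewrite !inE => /andP[/has_typeP g'z /eqP g'h]; apply/andP; split.
    by apply/has_typeP => x; rewrite FI_compE FI_permE zs.
  by apply/eqP/FI_homP => x; rewrite !FI_compE FI_permE -sh -g'h FI_compE.
rewrite inE => /andP[/has_typeP gz /eqP gh].
exists (FI_comp (FI_perm s^-1) g); last by rewrite FI_permKV.
rewrite inE; apply/andP; split.
  by apply/has_typeP => x; rewrite FI_compE FI_permE -zs permKV.
apply/eqP/FI_homP => x; rewrite !FI_compE FI_permE; apply: (canLR (permK s)).
by rewrite sh -gh FI_compE.
Qed.

Lemma card_has_type_res n S T (f : FI_hom S T) (z : partial_injection T)
    (h : FI_hom S (thick n)) :
  has_type (pinj_res f z) h ->
  #|[set g : FI_hom T (thick n) | has_type z g]| =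
  (#|[set h' : FI_hom S (thick n) | has_type (pinj_res f z) h']|
   * #|[set g | has_type z g & FI_comp g f == h]|)%N.
Proof.
move=> hz; rewrite -sum1_card.
rewrite (partition_big (fun g => FI_comp g f)
  (mem [set h' : FI_hom S (thick n) | has_type (pinj_res f z) h'])) /=; last first.
  by move=> g; rewrite !inE; apply: has_type_comp.
rewrite -sum_nat_const; apply: eq_bigr => h'; rewrite inE => h'z.
rewrite (card_extensions hz h'z) -sum1_card; apply: eq_bigl => g.
by rewrite !inE.
Qed.

Section Averaging.
Variable k : fieldType.
Hypothesis k_char0 : [pchar k] =i pred0.

(** Dividing by the number of morphisms of type z, which grows with n, takes
    characteristic 0. *)
Definition type_weight n T (z : partial_injection T) (h : FI_hom T (thick n)) : k :=
  (has_type z h)%:R / #|[set g : FI_hom T (thick n) | has_type z g]|%:R.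

Lemma natr_char0_neq0 n : (0 < n)%N -> n%:R != 0 :> k.
Proof. by rewrite (proj1 (pcharf0P k) k_char0) lt0n. Qed.

Lemma type_weight_sum n T (z : partial_injection T) :
  (exists h : FI_hom T (thick n), has_type z h) -> \sum_h type_weight (n := n) z h = 1.
Proof.
move=> [h hz]; rewrite -mulr_suml -natr_sum.
rewrite (sum_nat_pred predT) (eq_finset (has_type z)) => [|g]; last by rewrite andbT.
by rewrite divff // natr_char0_neq0 //; apply/card_gt0P; exists h; rewrite inE.
Qed.

Lemma type_weight_res n S T (f : FI_hom S T) (z : partial_injection T)
    (h : FI_hom S (thick n)) :
  (exists g : FI_hom T (thick n), has_type z g) ->
  \sum_(g | FI_comp g f == h) type_weight z g = type_weight (pinj_res f z) h.
Proof.
move=> [g0 g0z]; rewrite /type_weight; have [hz|nhz] := boolP (has_type _ h); last first.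
  rewrite mul0r big1 // => g /eqP gh; case: ifP || case gz: (has_type z g); last by rewrite mul0r.
  by rewrite -gh has_type_comp in nhz.
rewrite -mulr_suml -natr_sum.
rewrite sum_nat_pred.
have z_gt0 : (0 < #|[set g : FI_hom T (thick n) | has_type z g]|)%N.
  by apply/card_gt0P; exists g0; rewrite inE.
rewrite (card_has_type_res hz) muln_gt0 in z_gt0 *; case/andP: z_gt0 => fz_gt0 h_gt0.
by rewrite natrM invfM mulrC -mulrA mulVf ?natr_char0_neq0 // mulr1 mul1r.
Qed.

Definition pinj_averaging : averaging k pinj.
Proof.
apply: (@Averaging FI k pinj unit (fun _ _ => tt) (fun _ n => thick n)
  (fun _ n => thick_point n) (fun _ n T z h => type_weight z h)
  (fun _ n T z => exists h : FI_hom T (thick n), has_type z h)).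
- by [].
- by move=> T z; exists #|T| => n; apply: has_type_exists.
- by move=> _ n T z; apply: type_weight_sum.
- move=> _ n T z h; rewrite /type_weight.
  by have [/eqP //|_] := boolP (has_type z h); rewrite mul0r eqxx.
- by move=> _ n S T f z h; apply: type_weight_res.
Defined.

End Averaging.
End PartialInjections.

(** * Finitely generated injective FI-modules *)

Section FIModules.
Variable k : fieldType.
Hypothesis k_char0 : [pchar k] =i pred0.

Section Symmetry.
Variable X : module FI k.

Lemma FI_bijection (S T : finType) : #|S| = #|T| ->
  exists (f : FI_hom S T) (g : FI_hom T S), FI_comp g f = FI_id S /\ FI_comp f g = FI_id T.
Proof.
move=> eq_ST; have [f inj_f] : exists f : S -> T, injective f.
  by apply: injection_exists; rewrite eq_ST.
have [g fK gK] := inj_card_bij inj_f (eq_leq (esym eq_ST)).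
exists (FI_mk inj_f), (FI_mk (can_inj gK)).
by split; apply: FI_homP => x; rewrite FI_compE !FI_mkE.
Qed.

Lemma mod_map_iso_inj (S T : finType) (f : FI_hom S T) (g : FI_hom T S) :
  FI_comp g f = FI_id S -> injective (mod_map X f).
Proof.
move=> gf; apply: (can_inj (g := mod_map X g)) => x.
by rewrite -[RHS](mod_map_id (m := X)) -mod_map_comp /= gf.
Qed.

Lemma mod_map_permM (T : finType) (s t : {perm T}) x :
  mod_map X (FI_perm (s * t)) x = mod_map X (FI_perm t) (mod_map X (FI_perm s) x).
Proof. by rewrite FI_permM -mod_map_comp. Qed.

Lemma mod_map_perm1 (T : finType) (x : X T) : mod_map X (FI_perm 1) x = x.
Proof. by rewrite FI_perm1; apply: (mod_map_id (m := X)). Qed.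

Definition degree (e : element X) : nat := let S : finType := projT1 e in #|S|.

(** If the averages of v over all types vanish, so do its averages over the
    finer classes of the g that agree with a given h on a set of at most #|D|
    elements: after a permutation h takes its values in D, and then these classes
    are unions of types. *)
Lemma orbit_sum_eq0 (D S T : finType) n (v : X T) (a : FI_hom S T)
    (h : FI_hom S (thick D n)) :
  (#|S| <= #|D|)%N ->
  (forall z : partial_injection D T,
     \sum_(g : FI_hom T (thick D n) | has_type z g) mod_map X g v = 0) ->
  \sum_(g : FI_hom T (thick D n) | FI_comp g a == h) mod_map X g v = 0.
Proof.
move=> le_SD v0; have [f inj_f] := injection_exists le_SD.
have inj_h1 : injective (fun x => inl (f x) : thick D n) by move=> x y [/inj_f].
pose h1 : FI_hom S (thick D n) := FI_mk inj_h1.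
have h1_sum : \sum_(g : FI_hom T (thick D n) | FI_comp g a == h1) mod_map X g v = 0.
  rewrite (partition_big (fun g => pinj_res g (thick_point D n)) predT) //=.
  rewrite big1 // => z _.
  have [/has_typeP az|naz] := boolP (has_type (pinj_res a z) h1).
    rewrite -[RHS](v0 z); apply: eq_bigl => g.
    apply: andb_idl => /has_typeP gz; apply/eqP/FI_homP => x.
    have := az x; rewrite pinj_resE -gz FI_compE FI_mkE /=.
    by case: (FI_fun g _) => //= d [->].
  rewrite big1 // => g /andP[/eqP gh gz]; case/negP: naz.
  by rewrite -gh has_type_comp.
have [|s [sh _]] := perm_extension (zeta := fun _ : thick D n => tt) (@FI_inj _ _ h) inj_h1.
  by [].
apply: (mod_map_iso_inj (f := FI_perm s) (g := FI_perm s^-1)).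
  by apply: FI_homP => x; rewrite FI_compE !FI_permE permK FI_mkE.
rewrite linear0 -[RHS]h1_sum linear_sum.
rewrite [RHS](reindex (@FI_comp T _ _ (FI_perm s))) /=; last first.
  by exists (FI_comp (FI_perm s^-1)) => g _; rewrite ?FI_permK ?FI_permKV.
apply: eq_big => [g|g _]; last by rewrite mod_map_comp.
apply/eqP/eqP => [gh|gh]; apply: FI_homP => x.
  by rewrite !FI_compE FI_permE FI_mkE -sh -gh FI_compE.
apply: (@perm_inj _ s); rewrite sh FI_compE.
have := congr1 (fun f => FI_fun f x) gh.
by rewrite !FI_compE FI_permE FI_mkE.
Qed.

Lemma orbit_sum_perm_eq0 (D S T : finType) n (v : X T) (a h : FI_hom S T) :
  #|T| = #|thick D n| -> (#|S| <= #|D|)%N ->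
  (forall z : partial_injection D T,
     \sum_(g : FI_hom T (thick D n) | has_type z g) mod_map X g v = 0) ->
  \sum_(s : {perm T} | FI_comp (FI_perm s) a == h) mod_map X (FI_perm s) v = 0.
Proof.
move=> eq_T le_SD v0; have [b [b' [bK b'K]]] := FI_bijection eq_T.
have bKx x : FI_fun b' (FI_fun b x) = x by rewrite -FI_compE bK FI_mkE.
have b'Kx x : FI_fun b (FI_fun b' x) = x by rewrite -FI_compE b'K FI_mkE.
apply: (mod_map_iso_inj (f := b) bK); rewrite linear0 linear_sum.
rewrite -[RHS](orbit_sum_eq0 a (FI_comp b h) le_SD v0).
rewrite [RHS](reindex (fun s : {perm T} => FI_comp b (FI_perm s))) /=; last first.
  exists (fun g => perm (@FI_inj _ _ (FI_comp b' g))) => [s|g] _.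
    by apply/permP => x; rewrite permE !FI_compE FI_permE bKx.
  by apply: FI_homP => x; rewrite FI_compE FI_permE permE FI_compE b'Kx.
apply: eq_big => [s|s _]; last by rewrite mod_map_comp.
apply/eqP/eqP => [<-|sh]; apply: FI_homP => x; first by rewrite !FI_compE.
apply: (@FI_inj _ _ b); have := congr1 (fun f => FI_fun f x) sh.
by rewrite !FI_compE.
Qed.

(** The argument is that of Maschke's theorem. Assume that all averages of v vanish,
    and let W be the representation of the permutations of T spanned by v. A
    projector onto W, summed over its conjugates by permutations, maps the image of
    a generator to a combination of sums of translates of v over all permutations
    with given values at no more than #|D| points, which are 0; but it multiplies
    v by the number of permutations. *)
Lemma avg_type_neq0 (D : finType) m (e : 'I_m -> element X) (T : finType) n (v : X T) :
  generates e -> (forall i, degree (e i) <= #|D|)%N ->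
  #|T| = #|thick D n| -> v <> 0 ->
  exists z : pinj D T, good (pinj_averaging D k_char0) tt n z /\
    avg (A := pinj_averaging D k_char0) tt n z v <> 0.
Proof.
move=> gen_e e_small eq_T v_neq0; apply: contrapT => noz; apply: v_neq0.
have v0 (z : partial_injection D T) :
    \sum_(g : FI_hom T (thick D n) | has_type z g) mod_map X g v = 0.
  have [[g gz]|nz] := pselect (exists g : FI_hom T (thick D n), has_type z g); last first.
    by rewrite big1 // => g gz; case: nz; exists g.
  have avg0 : avg (A := pinj_averaging D k_char0) tt n (z : pinj D T) v = 0.
    by apply: contrapT => avg_neq0; apply: noz; exists z; split=> //; exists g.
  pose N : k := #|[set g : FI_hom T (thick D n) | has_type z g]|%:R.
  have N0 : N != 0.
    by rewrite natr_char0_neq0 //; apply/card_gt0P; exists g; rewrite inE.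
  transitivity (N *: avg (A := pinj_averaging D k_char0) tt n (z : pinj D T) v).
    2: by rewrite avg0 scaler0.
  rewrite /avg scaler_sumr big_mkcond; apply: eq_bigr => g' _.
  rewrite scalerA /= /type_weight mulrC mulfVK //.
  by case: has_type; rewrite ?scale1r ?scale0r.
pose W (w : X T) := exists c : {perm T} -> k, w = \sum_s c s *: mod_map X (FI_perm s) v.
have subW : subspace W.
  split; first by exists (fun=> 0); rewrite big1 // => s _; rewrite scale0r.
  move=> a u w [c ->] [d ->]; exists (fun s => a * c s + d s).
  rewrite scaler_sumr -big_split; apply: eq_bigr => s _.
  by rewrite scalerDl scalerA.
have [pi [piW pi_id]] := subspace_projector subW.
have Wv s : W (mod_map X (FI_perm s) v).
  exists (fun t => (t == s)%:R); rewrite (bigD1 s) //= eqxx scale1r.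
  by rewrite big1 ?addr0 // => t /negPf ->; rewrite scale0r.
have avg_pi0 x : \sum_(s : {perm T})
    mod_map X (FI_perm s) (pi (mod_map X (FI_perm s^-1) x)) = 0.
  have [y [ye ->]] := gen_e T x.
  under eq_bigr => s _ do rewrite !linear_sum.
  rewrite exchange_big big1 // => i _ /=; have [c ->] := ye i.
  under eq_bigr => s _ do rewrite !linear_sum.
  rewrite exchange_big big1 // => h _ /=.
  under eq_bigr => s _ do rewrite !linearZ /= -mod_map_comp.
  rewrite -scaler_sumr (partition_big (fun s : {perm T} =>
    FI_comp (FI_perm s^-1) h) predT) //= big1 ?scaler0 // => a _.
  have [d dE] := piW (mod_map X a (projT2 (e i))).
  transitivity (\sum_(t : {perm T}) d t *: \sum_(s : {perm T} |
      FI_comp (FI_perm s^-1) h == a) mod_map X (FI_perm (t * s)) v).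
    under [RHS]eq_bigr => t _ do rewrite scaler_sumr.
    rewrite [RHS]exchange_big; apply: eq_bigr => s /eqP ->.
    rewrite dE linear_sum; apply: eq_bigr => t _.
    by rewrite linearZ /= mod_map_permM.
  rewrite big1 // => t _.
  have sum0 := orbit_sum_perm_eq0 (FI_comp (FI_perm t^-1) a) h eq_T (e_small i) v0.
  rewrite [X in _ *: X](_ : _ = 0) ?scaler0 // -[RHS]sum0.
  rewrite [RHS](reindex (fun s : {perm T} => (t * s)%g)) /=; last first.
    by exists (fun s => (t^-1 * s)%g) => s _; rewrite mulgA ?mulVg ?mulgV mul1g.
  apply: eq_bigl => s; apply/eqP/eqP => [<-|<-]; apply: FI_homP => x';
    rewrite !FI_compE !FI_permE.
    by rewrite permM permKV permKV.
  by rewrite permM permKV permK.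
have perm_neq0 : #|{perm T}|%:R != 0 :> k.
  by rewrite natr_char0_neq0 //; apply/card_gt0P; exists 1%g.
have : #|{perm T}|%:R *: v = 0.
  rewrite -[RHS](avg_pi0 v) scaler_nat -sumr_const; apply: eq_bigr => s _.
  by rewrite pi_id // -mod_map_permM mulVg mod_map_perm1.
by move/eqP; rewrite scaler_eq0 (negPf perm_neq0) => /eqP.
Qed.

End Symmetry.

(** The elements of large degree are detected by partial injections to a set as
    large as the generators, as there the torsion vanishes, and those of small
    degree by the finitely many representables of small degree. *)
Theorem fg_injective_retract (X : module FI k) :
  finitely_generated X -> injective_module X ->
  exists (Z : presheaf FI) (A : averaging k Z), retract X (cofun k Z).
Proof.
move=> fgX injX; have [m [e gen_e]] := generates_of_fg fgX.
pose d := \max_i degree (e i).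
pose AD := pinj_averaging 'I_d k_char0.
have e_small i : (degree (e i) <= #|'I_d|)%N.
  by rewrite card_ord; apply: (leq_bigmax i).
have [n1 stable] := avg_eq0_stable gen_e (A := AD) (j := tt) (fun _ _ => erefl).
pose ZJ (i : option 'I_(d + n1)) : presheaf FI :=
  if i is Some j then representable (C := FI) 'I_j else pinj 'I_d.
pose AJ i : averaging k (ZJ i) :=
  if i is Some j then representable_averaging (C := FI) k 'I_j else AD.
have [T v v_neq0|r [f inj_f]] := cofun_embedding gen_e (Z := coprod ZJ).
  (* In small degrees the averages over a representable are constant sequences. *)
  have [lt_T|ge_T] := ltnP #|T| (d + n1).
    have [b [b' [bK _]]] : exists (f : FI_hom T 'I_#|T|) (g : FI_hom 'I_#|T| T),
        FI_comp g f = FI_id T /\ FI_comp f g = FI_id 'I_#|T|.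
      by apply: FI_bijection; rewrite card_ord.
    have [|g gP] := @cofun_separates FI k (coprod ZJ) (coprod_averaging AJ) X T v
      (existT (fun i => ZJ i T) (Some (Ordinal lt_T)) b).
      move=> [N avg0]; apply: v_neq0; apply: (mod_map_iso_inj (f := b) bK).
      rewrite linear0 -(representable_avg (X := X) N).
      rewrite -[LHS](coprod_avg (A := AJ) (i := Some (Ordinal lt_T)) tt N b v).
      exact: avg0.
    by exists g; eexists; apply: gP.
  (* The averages of v at stage #|T| - d do not all vanish, and this persists. *)
  pose n := (#|T| - d)%N.
  have [|z [gz avg_z]] := avg_type_neq0 (n := n) gen_e e_small _ v_neq0.
    by rewrite card_sum !card_ord subnKC // (leq_trans _ ge_T) // leq_addr.
  have [|g gP] := @cofun_separates FI k (coprod ZJ) (coprod_averaging AJ) X T v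
    (existT (fun i => ZJ i T) None z).
    move=> [N avg0]; apply: avg_z; apply: stable => //.
      by rewrite leq_subRL // (leq_trans _ ge_T) // leq_addr.
    exists N => N' /avg0 <-; apply: esym.
    exact: (coprod_avg (A := AJ) (i := None) tt N' z v).
  by exists g; eexists; apply: gP.
exists (coprod (fun _ : 'I_r => coprod ZJ)).
exists (coprod_averaging (fun _ => coprod_averaging AJ)).
exact: injective_mono_retract injX inj_f.
Qed.

End FIModules.

(** * Free FI-modules *)

Section FreeFIModules.
Variables (k : fieldType) (D : finType).

Fact restriction_subproof (T : finType) (B : {set D}) (a : FI_hom D T) :
  @partial_injective D T [ffun t => [pick d in B | FI_fun a d == t]].
Proof.
apply/partial_injectiveP => t t'; rewrite !ffunE.
case: pickP => // d /andP[_ /eqP <-] _; case: pickP => // d' /andP[_ /eqP <-].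
by move=> [->].
Qed.

Definition restriction (T : finType) (B : {set D}) (a : FI_hom D T) :
  partial_injection D T :=
  exist _ [ffun t => [pick d in B | FI_fun a d == t]] (restriction_subproof B a).

Lemma restrictionP (T : finType) (B : {set D}) (a : FI_hom D T) t d :
  reflect (d \in B /\ FI_fun a d = t) (val (restriction B a) t == Some d).
Proof.
rewrite ffunE; case: pickP => [d' /andP[d'B /eqP ad']|no_d].
  apply: (iffP eqP) => [[<-] //|[dB ad]]; congr Some.
  by apply: (@FI_inj _ _ a); rewrite ad'.
by apply: (iffP eqP) => // -[dB ad]; have := no_d d; rewrite dB ad eqxx.
Qed.

Lemma restriction_eq (T T' : finType) (B B' : {set D}) (a : FI_hom D T) (a' : FI_hom D T') t t' :
  (forall d, d \in B /\ FI_fun a d = t <-> d \in B' /\ FI_fun a' d = t') ->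
  val (restriction B a) t = val (restriction B' a') t'.
Proof.
move=> aa'; case e : (val (restriction B a) t) => [d|].
  by move/eqP/restrictionP/aa'/restrictionP/eqP: e.
case e' : (val (restriction B' a') t') => [d|] //.
by move/eqP/restrictionP/aa'/restrictionP/eqP: e'; rewrite e.
Qed.

Definition inverts (T : finType) (z : partial_injection D T) (a : FI_hom D T) :=
  [forall d, val z (FI_fun a d) == Some d].

Lemma inverts_restriction (T : finType) (B : {set D}) (a a' : FI_hom D T) :
  inverts (restriction B a) a' = (B == setT) && (a' == a).
Proof.
apply/forallP/andP => [inv_a|[/eqP-> /eqP->] d]; last first.
  by apply/restrictionP; rewrite inE.
split; first by apply/eqP/setP => d; have /restrictionP[-> _] := inv_a d; rewrite inE.
by apply/eqP/FI_homP => d; have /restrictionP[] := inv_a d.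
Qed.

(** A function on injections D -> T is extended to partial injections T -> D by
    summing it over the injections that they invert; Moebius inversion over the
    subsets of D recovers it. The inversion is natural because the terms with and
    without a point d cancel when d is sent outside the image of the morphism. *)
Lemma free_module_FI_retract : [pchar k] =i pred0 ->
  retract (free_module (C := FI) k D) (cofun k (pinj D)).
Proof.
move=> k_char0.
have [|S T f x|i iE] := @nattrans_of_fun FI k (free_module (C := FI) k D) (cofun k (pinj D))
  (fun T x => [ffun z => \sum_(a | inverts z a) (x : {ffun FI_hom D T -> k^o}) a]).
- move=> T c u v; apply/ffunP => z; rewrite !ffunE scaler_sumr -big_split.
  by apply: eq_bigr => a _; rewrite !ffunE.
- apply/ffunP => z; rewrite cofun_mapE !ffunE.
  under eq_bigr do rewrite ffunE.
  rewrite (exchange_big_dep predT) //= [RHS]big_mkcond; apply: eq_bigr => a _.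
  have -> : inverts (pinj_res f z) a = inverts z (FI_comp f a).
    by apply: eq_forallb => d; rewrite pinj_resE FI_compE.
  case: ifP => inv_a.
    rewrite (big_pred1 (FI_comp f a)) // => a' /=; rewrite eq_sym andbC.
    by case: eqVneq => // ->; rewrite inv_a.
  by rewrite big1 // => a' /andP[+ /eqP a'E]; rewrite -a'E inv_a.
have [|S T f phi|p pE] := @nattrans_of_fun FI k (cofun k (pinj D)) (free_module (C := FI) k D)
  (fun T phi => [ffun a : FI_hom D T =>
     \sum_(B : {set D}) (-1) ^+ #|~: B| * (phi (restriction B a) : k)]).
- move=> T c u v; apply/ffunP => a; rewrite !ffunE scaler_sumr -big_split.
  apply: eq_bigr => B _; rewrite !ffunE mulrDr; congr (_ + _).
  by rewrite [RHS]mulrCA.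
- apply/ffunP => a; rewrite !ffunE; under eq_bigr do rewrite cofun_mapE.
  have [/existsP[b /eqP fb]|nb] := boolP [exists b, FI_comp f b == a].
    rewrite (big_pred1 b) ?ffunE => [|b']; last first.
      apply/eqP/eqP => [|-> //]; rewrite -fb => /(congr1 (@FI_fun _ _)) e.
      apply: FI_homP => d; apply: (@FI_inj _ _ f).
      by have := congr1 (fun g => g d) e; rewrite /= !FI_compE.
    apply: eq_bigr => B _; congr (_ * phi _); apply: pinj_eqP => t.
    rewrite pinj_resE; apply: restriction_eq => d; rewrite -fb FI_compE.
    by split=> -[-> e]; split=> //; [apply: FI_inj e | rewrite e].
  rewrite [RHS]big_pred0 => [|b]; last first.
    by apply: contraNF nb => fb; apply/existsP; exists b.
  have [d da] : exists d, forall t, FI_fun f t != FI_fun a d.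
    apply: contrapT => nd; have {nd} fa d : exists t, FI_fun f t = FI_fun a d.
      apply: contrapT => nt; apply: nd; exists d => t; apply/eqP => ft.
      by apply: nt; exists t.
    have [b bE] := choice fa; case/existsP: nb.
    have inj_b : injective b by move=> d d' e; apply: (@FI_inj _ _ a); rewrite -!bE e.
    by exists (FI_mk inj_b); apply/eqP/FI_homP => d; rewrite FI_compE FI_mkE.
  (* The terms for B and for B with d added or removed cancel. *)
  pose toggle (B : {set D}) := if d \in B then B :\ d else d |: B.
  have toggleK : involutive toggle.
    move=> B; rewrite /toggle; have [dB|dB] := boolP (d \in B) => /=.
      by rewrite setD11 setD1K.
    by rewrite setU11 setU1K.
  set s := \sum_(B : {set D}) _.
  have sN : s = - s.
    rewrite {1}/s (reindex_inj (inv_inj toggleK)) /s -sumrN; apply: eq_bigr => B _.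
    rewrite -mulNr; congr (_ * phi _).
      have card_toggle : (-1) ^+ #|~: toggle B| = - (-1) ^+ #|~: B| :> k.
        rewrite /toggle; case: ifPn => dB.
          have -> : ~: (B :\ d) = d |: ~: B by apply/setP => y; rewrite !inE negb_and negbK.
          by rewrite cardsU1 inE dB exprS mulN1r.
        have -> : ~: B = d |: ~: (d |: B).
          by apply/setP => y; rewrite !inE; case: eqVneq => // ->.
        by rewrite [in RHS]cardsU1 !inE eqxx exprS mulN1r opprK.
      exact: card_toggle.
    apply: pinj_eqP => t; rewrite !pinj_resE; apply: restriction_eq => d'.
    have [->|d'd] := eqVneq d' d.
      by split=> -[_ /esym/eqP e]; rewrite (negPf (da t)) in e.
    by rewrite /toggle; case: ifP; rewrite !inE (negPf d'd).
  have : s *+ 2 = 0 by rewrite mulr2n {2}sN subrr.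
  by move/eqP; rewrite -mulr_natr mulf_eq0 (negPf (natr_char0_neq0 k_char0 _)) // orbF => /eqP.
exists i, p => T x; apply/ffunP => a; rewrite pE ffunE (bigD1 setT) //=.
rewrite setCT cards0 expr0 mul1r iE ffunE (big_pred1 a) => [|a']; last first.
  by rewrite inverts_restriction eqxx.
rewrite big1 ?addr0 // => B /negPf BT; rewrite ffunE big_pred0 ?mulr0 // => a'.
by rewrite inverts_restriction BT.
Qed.

End FreeFIModules.

(** * External tensor products *)

Section TensorSpan.
Variables (k : fieldType) (m : nat) (V : 'I_m -> lmodType k).

Lemma dfwith_id (x : forall i, V i) i : dfwith x (x i) = x.
Proof. by apply: functional_extensionality_dep => j; case: dfwithP. Qed.

(** The factors are brought into the spanning sets one coordinate at a time. *)
Lemma tensor_span (G : forall i, V i -> Prop) (U : tensor V -> Prop) :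
  (forall i (P : V i -> Prop), subspace P -> (forall u, G i u -> P u) -> forall u, P u) ->
  subspace U -> (forall x, (forall i, G i (x i)) -> U (pure_tensor x)) ->
  forall t, U t.
Proof.
move=> spanG subU UG.
have U_pure (j : nat) : forall x, (forall i : 'I_m, (j <= i)%N -> G i (x i)) ->
    U (pure_tensor x).
  elim: j => [|j IH] x xG; first by apply: UG => i; apply: xG.
  have [lt_jm|le_mj] := ltnP j m; last first.
    by apply: IH => i /leq_ltn_trans/(_ (ltn_ord i)); rewrite ltnNge le_mj.
  pose i0 := Ordinal lt_jm; rewrite -(dfwith_id x i0); move: (x i0).
  apply: (spanG i0) => [|u Gu].
    split=> [|a u v Uu Uv]; last by rewrite pure_tensor_multilinear; apply: subspaceP.
    have := pure_tensor_multilinear x 1 (0 : V i0) 0.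
    rewrite scaler0 add0r scale1r => /eqP.
    by rewrite -subr_eq0 opprD addrA subrr sub0r oppr_eq0 => /eqP ->; apply: subspace0.
  apply: IH => i; case: dfwithP => // i' i0i' le_ji.
  by apply: xG; rewrite ltn_neqAle le_ji andbT.
have [pi [piU pi_id]] := subspace_projector subU => t.
have <- : pi t = t; last exact: piU.
by apply: (@tensor_ext _ _ _ _ pi idfun) => x; apply/pi_id/(U_pure m) => i; rewrite leqNgt ltn_ord.
Qed.

End TensorSpan.

Section ExternalTensorTheory.
Variables (k : fieldType) (m : nat).

Definition delta_fun (Q : finType) (q : Q) : {ffun Q -> k^o} := [ffun q' => (q' == q)%:R].

Lemma delta_fun_span (Q : finType) (P : {ffun Q -> k^o} -> Prop) :
  subspace P -> (forall u, (exists q, u = delta_fun q) -> P u) -> forall u, P u.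
Proof.
move=> subP Pdelta u; have -> : u = \sum_q (u q : k) *: delta_fun q.
  apply/ffunP => q; rewrite sum_ffunE (bigD1 q) //= !ffunE eqxx.
  rewrite big1 ?addr0 => [|q' /negPf qq']; first by rewrite [RHS]mulr1.
  by rewrite !ffunE eq_sym qq' scaler0.
by apply: subspace_sum => // q _; apply: subspaceZ => //; apply: Pdelta; exists q.
Qed.

Lemma prod_delta_fun (Q : 'I_m -> finType) (z w : {dffun forall i, Q i}) :
  \prod_i (delta_fun (z i) (w i) : k) = (w == z)%:R.
Proof.
have [->|ne] := eqVneq w z; first by rewrite big1 // => i _; rewrite ffunE eqxx.
have /existsP[i wz] : [exists i, w i != z i].
  rewrite -negb_forall; apply: contra ne => /forallP wz.
  by apply/eqP/ffunP => i; apply/eqP.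
by rewrite (bigD1 i) //= ffunE (negPf wz) mul0r.
Qed.

Section FunctionSpaces.
Variable Q : 'I_m -> finType.

Let V i : lmodType k := {ffun Q i -> k^o}.
Let Q_prod : finType := {dffun forall i, Q i}.

Definition of_product (phi : {ffun Q_prod -> k^o}) : tensor V :=
  \sum_z (phi z : k) *: pure_tensor (fun i => delta_fun (z i) : V i).

(** It suffices to compare on delta functions, which span both sides. *)
Lemma tensor_function_spaces :
  exists f : {linear tensor V -> {ffun Q_prod -> k^o}},
    [/\ forall x z, f (pure_tensor x) z = \prod_i (x i (z i) : k),
     cancel of_product f & cancel f of_product].
Proof.
pose phi (x : forall i, V i) : {ffun Q_prod -> k^o} :=
  [ffun z : Q_prod => \prod_i (x i (z i) : k)].
have phi_lin : multilinear phi.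
  move=> x i a u v; apply/ffunP => z; rewrite !ffunE.
  have split_i (w : V i) : \prod_j (dfwith x w j (z j) : k)
      = (w (z i) : k) * \prod_(j | j != i) (x j (z j) : k).
    rewrite (bigD1 i) //= dfwith_in; congr (_ * _).
    by apply: eq_bigr => j ji; rewrite dfwith_out // eq_sym.
  by rewrite !split_i !ffunE mulrDl -mulrA.
have [f [f_pure _]] := tensor_universal phi_lin; exists f.
have fE x z : f (pure_tensor x) z = \prod_i (x i (z i) : k) by rewrite f_pure ffunE.
have f_delta (z : Q_prod) :
    f (pure_tensor (fun i => delta_fun (z i) : V i)) = delta_fun z.
  by apply/ffunP => w; rewrite fE prod_delta_fun ffunE.
have of_delta (z : Q_prod) :
    of_product (delta_fun z) = pure_tensor (fun i => delta_fun (z i) : V i).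
  rewrite /of_product (bigD1 z) //= ffunE eqxx scale1r big1 ?addr0 // => w /negPf wz.
  by rewrite ffunE wz scale0r.
have of_lin : linear of_product.
  move=> a u v; rewrite /of_product scaler_sumr -big_split; apply: eq_bigr => z _.
  by rewrite !ffunE scalerDl scalerA.
split=> // [u|t].
  apply: (@delta_fun_span _ (fun u => f (of_product u) = u)) => [|w [z ->]].
    have of0 : of_product 0 = 0.
      by have := of_lin 1 0 0; rewrite !scale1r addr0 => /esym/eqP; rewrite -subr_eq0 addrK => /eqP.
    split=> [|a w w' fw fw']; first by rewrite of0 linear0.
    by rewrite of_lin linearP /= fw fw'.
  by rewrite of_delta f_delta.
have [g gE] := linear_of_fun of_lin.
apply: (@tensor_span k m V (fun i u => exists q, u = delta_fun q)
  (fun t => of_product (f t) = t)) => [i P||x xd].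
- exact: delta_fun_span.
- split=> [|a u v fu fv]; first by rewrite -gE !linear0.
  by rewrite linearP /= of_lin fu fv.
have [q qE] : exists q : forall i, Q i, forall i, x i = delta_fun (q i).
  by exists (fun i => projT1 (cid (xd i))) => i; apply: projT2 (cid (xd i)).
pose z : Q_prod := [ffun i => q i].
have -> : x = fun i => delta_fun (z i).
  by apply: functional_extensionality_dep => i; rewrite ffunE.
by rewrite f_delta of_delta.
Qed.

End FunctionSpaces.

End ExternalTensorTheory.

Section ExternalTensorModules.
Variables (C : fincat) (k : fieldType) (m : nat).
Implicit Types V W : 'I_m -> module C k.

(** Thanks to this, naturality has to be checked in one direction only. *)
Lemma nattrans_inverse (D : fincat) (X Y : module D k) (f : nattrans X Y)
    (g : forall S, Y S -> X S) :
  (forall S, cancel (g S) (f S)) -> (forall S, cancel (f S) (g S)) ->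
  exists g' : nattrans Y X, forall S, g' S =1 g S.
Proof.
move=> gK fK; have [S a u v|S T h y|g' g'E] := @nattrans_of_fun D k Y X g.
- by apply: (can_inj (fK S)); rewrite linearP !gK.
- by apply: (can_inj (fK T)); rewrite nt_natural !gK.
by exists g'.
Qed.

Lemma ext_tensor_nattrans V W (f : forall i, nattrans (V i) (W i)) :
  exists g : nattrans (ext_tensor V) (ext_tensor W), forall S x,
    g S (pure_tensor x) = pure_tensor (fun i => f i (S i) (x i)).
Proof.
pose g (S : Ob (pow_cat C m)) : {linear ext_tensor V S -> ext_tensor W S} :=
  tensor_map (fun i => (f i (S i) : {linear V i (S i) -> W i (S i)})).
have nat_g S T (h : Hom S T) : g T \o mod_map (ext_tensor V) h
    =1 mod_map (ext_tensor W) h \o g S.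
  apply: tensor_ext => x /=; rewrite /g !tensor_map_pure_tensor; congr pure_tensor.
  by apply: functional_extensionality_dep => i; rewrite nt_natural.
exists (@NatTrans (pow_cat C m) k (ext_tensor V) (ext_tensor W) g nat_g) => S x.
exact: tensor_map_pure_tensor.
Qed.

Lemma ext_tensor_retract V W :
  (forall i, retract (V i) (W i)) -> retract (ext_tensor V) (ext_tensor W).
Proof.
move=> VW; pose f i := projT1 (cid (VW i)).
pose g i := projT1 (cid (projT2 (cid (VW i)))).
have fg i : forall S x, g i S (f i S x) = x := projT2 (cid (projT2 (cid (VW i)))).
have [F FE] := ext_tensor_nattrans f; have [G GE] := ext_tensor_nattrans g.
exists F, G => S; apply: (@tensor_ext _ _ _ _ (G S \o F S) idfun) => x /=.
rewrite FE GE; congr pure_tensor.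
by apply: functional_extensionality_dep => i; rewrite fg.
Qed.

Lemma ext_tensor_fg V :
  (forall i, finitely_generated (V i)) -> finitely_generated (ext_tensor V).
Proof.
move=> fgV; have genV i := generates_of_fg (fgV i).
pose n i := projT1 (cid (genV i)); pose e i := projT1 (cid (projT2 (cid (genV i)))).
have gen_e i : generates (e i : 'I_(n i) -> _) := projT2 (cid (projT2 (cid (genV i)))).
pose I : finType := {dffun forall i, 'I_(n i)}.
pose E (b : I) : element (ext_tensor V) :=
  existT _ (fun i => projT1 (e i (b i))) (pure_tensor (fun i => projT2 (e i (b i)))).
apply: (@fg_of_generates _ _ _ I E) => T.
apply: (@tensor_span k m (fun i => V i (T i))
  (fun i u => exists a h, u = mod_map (V i) h (projT2 (e i a)))).
- move=> i P subP PG u; have [y [ye ->]] := gen_e i (T i) u.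
  apply: subspace_sum => // a _; have [c ->] := ye a.
  apply: subspace_sum => // h _; apply: subspaceZ => //.
  by apply: PG; exists a, h.
- split=> [|a u v [y [ye ->]] [z [ze ->]]].
    exists (fun=> 0); split=> [b|]; last by rewrite big1.
    by exists (fun=> 0); rewrite big1 // => h _; rewrite scale0r.
  exists (fun b => a *: y b + z b); split=> [b|].
    have [c ->] := ye b; have [d ->] := ze b; exists (fun h => a * c h + d h).
    rewrite scaler_sumr -big_split; apply: eq_bigr => h _.
    by rewrite scalerDl scalerA.
  by rewrite scaler_sumr -big_split.
move=> x xG; have [b xb] : exists b : I, forall i, exists h,
    x i = mod_map (V i) h (projT2 (e i (b i))).
  exists [ffun i => projT1 (cid (xG i))] => i.
  by rewrite ffunE; apply: projT2 (cid (xG i)).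
pose h i := projT1 (cid (xb i)).
have xE i : x i = mod_map (V i) (h i) (projT2 (e i (b i))) := projT2 (cid (xb i)).
exists (fun b' => if b' == b then pure_tensor x else 0); split=> [b'|]; last first.
  by rewrite (bigD1 b) //= eqxx big1 ?addr0 // => b' /negPf ->.
have [->|_] := eqVneq b' b; last first.
  by exists (fun=> 0); rewrite big1 // => g _; rewrite scale0r.
pose hb : Hom (projT1 (E b)) T := finfun h.
exists (fun g => (g == hb)%:R); rewrite (bigD1 hb) //= eqxx scale1r big1 => [|g /negPf ->].
  rewrite addr0 /ext_tensor_map tensor_map_pure_tensor; congr pure_tensor.
  by apply: functional_extensionality_dep => i; rewrite xE ffunE.
by rewrite scale0r.
Qed.

Lemma ext_tensor_cofun (Z : 'I_m -> presheaf C) :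
  retract (ext_tensor (fun i => cofun k (Z i))) (cofun k (ext_prod Z)).
Proof.
pose f_ex (S : Ob (pow_cat C m)) := cid (tensor_function_spaces k (fun i => Z i (S i))).
pose f S : {linear ext_tensor (fun i => cofun k (Z i)) S -> cofun k (ext_prod Z) S} :=
  projT1 (f_ex S).
have f_pure S x z : f S (pure_tensor x) z = \prod_i (x i (z i) : k).
  by have [fE _ _] := projT2 (f_ex S); apply: fE.
have nat_f S T (h : Hom S T) : f T \o mod_map (ext_tensor (fun i => cofun k (Z i))) h
    =1 mod_map (cofun k (ext_prod Z)) h \o f S.
  apply: tensor_ext => x; apply/ffunP => z.
  rewrite [RHS]cofun_mapE /= tensor_map_pure_tensor !f_pure.
  by apply: eq_bigr => i _; rewrite cofun_mapE ffunE.
pose F := @NatTrans (pow_cat C m) k (ext_tensor (fun i => cofun k (Z i)))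
  (cofun k (ext_prod Z)) f nat_f.
have [S|S|G GE] := @nattrans_inverse _ _ _ F (fun S => @of_product k m _).
- by have [_ ofK _] := projT2 (f_ex S); apply: ofK.
- by have [_ _ fK] := projT2 (f_ex S); apply: fK.
exists F, G => S x; rewrite GE.
by have [_ _] := projT2 (f_ex S); apply.
Qed.

(** The comparison map of M(S) comes from Yoneda, and pointwise it is the
    identification of functions on a product of sets of morphisms with tensors. *)
Lemma free_module_ext_tensor (S : Ob (pow_cat C m)) :
  retract (free_module k S) (ext_tensor (fun i => free_module k (S i))).
Proof.
pose x0 : ext_tensor (fun i => free_module k (S i)) S :=
  pure_tensor (fun i => free_basis k (idm (S i))).
have [F FE] := yoneda x0.
have FE' T v : F T v = of_product (Q := fun i => Hom (S i) (T i)) v.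
  rewrite FE; apply: eq_bigr => h _; congr (_ *: _).
  rewrite /= tensor_map_pure_tensor; congr pure_tensor.
  apply: functional_extensionality_dep => i; rewrite /= free_map_basis compm1.
  by apply/ffunP => g; rewrite !ffunE.
pose f_ex (T : Ob (pow_cat C m)) := cid (tensor_function_spaces k (fun i => Hom (S i) (T i))).
have [T x|T v|G GE] := @nattrans_inverse _ _ _ F (fun T => projT1 (f_ex T)).
- by rewrite FE'; have [_ _] := projT2 (f_ex T); apply.
- by rewrite FE'; have [_ fK _] := projT2 (f_ex T); apply: fK.
exists F, G => T v; rewrite GE FE'.
by have [_ fK _] := projT2 (f_ex T); apply: fK.
Qed.

End ExternalTensorModules.

(** Retracts are preserved by the external tensor product, and that of function
    modules is a function module again, with product averages. *)
Theorem ext_tensor_injective (m : nat) (k : fieldType) (V : 'I_m -> module FI k) :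
  [pchar k] =i pred0 -> (forall i, finitely_generated (V i)) ->
  (forall i, injective_module (V i)) -> injective_module (ext_tensor V).
Proof.
move=> k_char0 fgV injV; have emb i := fg_injective_retract k_char0 (fgV i) (injV i).
pose Z i := projT1 (cid (emb i)).
have embZ i : exists A : averaging k (Z i), retract (V i) (cofun k (Z i)) :=
  projT2 (cid (emb i)).
pose A i := projT1 (cid (embZ i)).
apply: (injective_retract _ (cofun_injective (ext_prod_averaging A))).
apply: (retract_trans _ (ext_tensor_cofun k Z)).
by apply: ext_tensor_retract => i; apply: projT2 (cid (embZ i)).
Qed.

Theorem theorem1p1 (m : nat) (k : fieldType)
    (m_gt0 : (0 < m)%N) (k_char0 : [pchar k]%R =i pred0) :
  (forall V : 'I_m -> module FI k,
     (forall i, finitely_generated (V i)) ->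
     (forall i, injective_module (V i)) ->
     finitely_generated (ext_tensor V) /\ injective_module (ext_tensor V)) /\
  (forall P : module (pow_cat FI m) k,
     finitely_generated P -> projective_module P -> injective_module P).
Proof.
split=> [V fgV injV|P fgP projP].
  by split; [apply: ext_tensor_fg | apply: ext_tensor_injective].
apply: projective_injective fgP projP => S.
apply: (injective_retract (free_module_ext_tensor k S)).
apply: ext_tensor_injective => // i; first exact: free_module_fg.
exact: injective_retract (free_module_FI_retract _ k_char0)
  (cofun_injective (pinj_averaging _ k_char0)).
Qed.
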